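(* Let $n\ge 2$, $\iota\in\{0,1,\dots,n-2\}$, and let $\mathcal O_1,\dots,\mathcal O_N$ be distinct orbits of $\mathrm{Aut}(\mathcal T_n)$ on $\mathrm{Clop}^\circ_\iota(\mathcal T_n)$. Put $\Pi_p=\mathcal O_p$ for $1\le p\le N$, let $\Pi_{N+1}$ be the complement of $\mathcal O_1\sqcup\dots\sqcup\mathcal O_N$ in $\mathrm{Clop}^\circ_\iota(\mathcal T_n)$, and let $k=N+1$. For $g\in\mathrm{Hier}(\mathcal T_n)$ let $\theta_{p,q}(g)$ be the number of $\Omega\in\Pi_p$ with $g\Omega\in\Pi_q$. Then $\theta_{p,q}(g)$ is finite for all $p\ne q$. Let $S=(s_{pq})$ be a real symmetric positive semidefinite $k\times k$ matrix with $s_{pp}=1$ for all $p$. Let $V$ be a Euclidean space spanned by unit vectors $e_1,\dots,e_k$ with $\langle e_p,e_q\rangle_V=s_{pq}$, and let $V_{\mathbb C}$ be its complexification. Then $\mathrm{Hier}(\mathcal T_n)$ acts by permutations of factors in the Hilbert space tensor product $$\bigotimes_{p=1}^{k}\ \bigotimes_{\Omega\in\Pi_p}(V_{\mathbb C},e_p),$$ and the restriction of this unitary representation to the cyclic span of the vector $\mathcal E=\bigotimes_{p=1}^k e_p^{\otimes\Pi_p}$ is an irreducible $\mathrm{Aut}(\mathcal T_n)$-spherical representation of $\mathrm{Hier}(\mathcal T_n)$ with spherical vector $\mathcal E$ and spherical function $$\Phi_S(g)=\prod_{p,q=1}^k s_{pq}^{\theta_{p,q}(g)}$$ (with the conventions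 $0^0=1$ and $1^{\infty}=1$).
   Context: $\mathcal T_n$ ($n\ge2$) is the infinite tree in which each vertex belongs to exactly $n+1$ edges. $\mathrm{Aut}(\mathcal T_n)$ is its automorphism group, with the topology in which stabilizers of finite subtrees are open. The boundary $\mathrm{Abs}(\mathcal T_n)$ is the set of equivalence classes of ways (infinite non-backtracking sequences of successively adjacent vertices, two being equivalent if they coincide eventually up to a shift of index). Cutting $\mathcal T_n$ at the midpoint of an edge gives two branches; the set of boundary points represented by ways lying in a branch is a ball; balls are declared clopen, which defines the topology of $\mathrm{Abs}(\mathcal T_n)$. A spheromorphism is a homeomorphism of $\mathrm{Abs}(\mathcal T_n)$ which in a neighborhood of each point coincides with some element of $\mathrm{Aut}(\mathcal T_n)$. $\mathrm{Hier}(\mathcal T_n)$ is the group of all spheromorphisms, with the group topology in which $\mathrm{Aut}(\mathcal T_n)$ is an open and closed subgroup. $\mathrm{Clop}^\circ(\mathcal T_n)$ is the set of nonempty proper clopen subsets of $\mathrm{Abs}(\mathcal T_n)$. Any such set is a disjoint union of finitely many balls, and the number of balls modulo $n-1$ depends only on the set; $\mathrm{Clop}^\circ_\iota(\mathcal T_n)$ denotes the subset of those for which this number is congruent to $\iota$ modulo $n-1$. It is invariant under $\mathrm{Hier}(\mathcal T_n)$, which acts by $\Omega\mapsto g\Omega$. The tensor product $\bigotimes_j(H_j,\xi_j)$ of a countable family of Hilbert spaces $H_j$ with distinguished unit vectors $\xi_j\in H_j$ is the Hilbert space completion of the span of the vectors $\otimes_j x_j$ with $x_j=\xi_j$ for all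 but finitely many $j$, with $\langle\otimes x_j,\otimes y_j\rangle=\prod_j\langle x_j,y_j\rangle$. An irreducible unitary representation $\rho$ of $G$ is $K$-spherical ($K\subset G$) if its space contains a nonzero $K$-fixed vector $v$ (the spherical vector), unique up to a scalar factor; the spherical function is $\Phi(g)=\langle\rho(g)v,v\rangle$ with $\|v\|=1$. The cyclic span of a vector is the closed linear span of its orbit under the group. *)

(* Defs.v *)
From HB Require Import structures.
From mathcomp Require Import all_boot all_order all_algebra.
From mathcomp Require Import finmap complex ring.
From mathcomp Require Import all_classical reals topology normedtype.

Set Implicit Arguments.
Unset Strict Implicit.
Unset Printing Implicit Defensive.

Import Order.TTheory GRing.Theory Num.Theory.
Import numFieldNormedType.Exports.

Local Open Scope classical_set_scope.
Local Open Scope ring_scope.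

Record regTree (n : nat) := RegTree {
  vertex :> choiceType;
  adj : rel vertex;
  adj_sym : symmetric adj;
  adj_irr : irreflexive adj;
  tree_inhabited : inhabited vertex;
  tree_connected : forall x y, exists2 p, path adj x p & last x p = y;
  tree_acyclic : forall c, ucycle adj c -> (size c <= 2)%N;
  tree_regular : forall x, ([set y | adj x y] #= `I_n.+1)%card }.

Section Tree.
Variables (n : nat) (T : regTree n).

Record aut := Aut {
  aut_fun :> T -> T;
  aut_bij : bijective aut_fun;
  aut_adj : forall x y, adj (aut_fun x) (aut_fun y) = adj x y }.

Record way := Way {
  way_fun :> nat -> T;
  way_adj : forall i, adj (way_fun i) (way_fun i.+1);
  way_nonbacktracking : forall i, way_fun i != way_fun i.+2 }.

HB.instance Definition _ := gen_eqMixin way.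
HB.instance Definition _ := gen_choiceMixin way.

Definition way_eqv (w w' : way) : bool :=
  `[< exists a b, forall i, w (a + i)%N = w' (b + i)%N >].

Fact way_eqv_refl : reflexive way_eqv.
Proof. by move=> w; apply/asboolP; exists 0%N, 0%N. Qed.

Fact way_eqv_sym : symmetric way_eqv.
Proof.
by move=> w w'; apply/asboolP/asboolP => -[a [b ab]]; exists b, a => i.
Qed.

Fact way_eqv_trans : transitive way_eqv.
Proof.
move=> w' w w'' /asboolP[a [b ab]] /asboolP[c [d cd]].
apply/asboolP; exists (a + c)%N, (d + b)%N => i.
by rewrite -addnA ab addnCA cd addnA.
Qed.

Canonical way_equiv := EquivRel way_eqv way_eqv_refl way_eqv_sym way_eqv_trans.

Definition boundary := {eq_quot way_equiv}%qT.

HB.instance Definition _ := Choice.on boundary.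
HB.instance Definition _ := Quotient.on boundary.

Definition way_end (w : way) : boundary := (\pi_boundary w)%qT.

(** Cutting the edge {a, b}: [branch a b] is the half containing [b], that is
    the connected component of [b] once the edge is removed. *)
Definition cut_adj (a b : T) : rel T := fun x y =>
  adj x y && ~~ ((x == a) && (y == b) || (x == b) && (y == a)).

Definition branch (a b : T) : set T :=
  [set x | exists2 p, path (cut_adj a b) b p & last b p = x].

Definition tree_ball (a b : T) : set boundary :=
  [set x | exists2 w : way, x = way_end w & forall i, branch a b (w i)].

Definition tree_balls : set (set boundary) :=
  [set B | exists a b, adj a b /\ B = tree_ball a b].

(** The complement of [tree_ball a b] is [tree_ball b a], so taking balls as a
    subbase of open sets makes them clopen. *)
HB.instance Definition _ :=
  isSubBaseTopological.Build boundary tree_balls (@id (set boundary)).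

Fact way_map_adj (h : aut) (w : way) i : adj (h (w i)) (h (w i.+1)).
Proof. by rewrite aut_adj way_adj. Qed.

Fact way_map_nonbacktracking (h : aut) (w : way) i : h (w i) != h (w i.+2).
Proof. by rewrite (bij_eq (aut_bij h)) way_nonbacktracking. Qed.

Definition way_map (h : aut) (w : way) : way :=
  Way (way_map_adj h w) (way_map_nonbacktracking h w).

Definition aut_map (h : aut) (x : boundary) : boundary :=
  way_end (way_map h (repr x)).

Lemma aut_map_end (h : aut) (w : way) :
  aut_map h (way_end w) = way_end (way_map h w).
Proof.
have /eqmodP/asboolP[a [b ab]] :
    (\pi_boundary (repr (way_end w)) = \pi_boundary w)%qT by rewrite reprK.
by apply/eqmodP/asboolP; exists a, b => i /=; rewrite ab.
Qed.

Lemma boundary_ind (P : boundary -> Prop) :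
  (forall w, P (way_end w)) -> forall x, P x.
Proof. by move=> Pw x; rewrite -[x]reprK; exact: Pw. Qed.

Lemma way_eq (w w' : way) : way_fun w =1 way_fun w' -> way_end w = way_end w'.
Proof. by move=> ww'; apply/eqmodP/asboolP; exists 0%N, 0%N => i; exact: ww'. Qed.

Definition aut_id : aut := Aut (inv_bij (frefl id)) (fun _ _ => erefl).

Fact aut_comp_adj (h k : aut) x y : adj ((h \o k) x) ((h \o k) y) = adj x y.
Proof. by rewrite /= !aut_adj. Qed.

Definition aut_comp (h k : aut) : aut :=
  Aut (bij_comp (aut_bij h) (aut_bij k)) (aut_comp_adj h k).

Lemma aut_map_id : aut_map aut_id =1 id.
Proof. by elim/boundary_ind => w; rewrite aut_map_end; exact: way_eq. Qed.

Lemma aut_map_comp (h k : aut) : aut_map (aut_comp h k) =1 aut_map h \o aut_map k.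
Proof. by elim/boundary_ind => w /=; rewrite !aut_map_end; exact: way_eq. Qed.

Lemma aut_inv_ex (h : aut) : exists k : aut, cancel h k /\ cancel k h.
Proof.
case: (aut_bij h) => k hk kh.
have kadj x y : adj (k x) (k y) = adj x y by rewrite -(aut_adj h) !kh.
by exists (Aut (Bijective kh hk) kadj).
Qed.

Definition aut_inv (h : aut) : aut := projT1 (cid (aut_inv_ex h)).

Lemma aut_mapK (h : aut) : cancel (aut_map h) (aut_map (aut_inv h)).
Proof.
rewrite /aut_inv; case: cid => k /= [hk kh].
by elim/boundary_ind => w; rewrite !aut_map_end; apply: way_eq => i /=; rewrite hk.
Qed.

Lemma aut_mapVK (h : aut) : cancel (aut_map (aut_inv h)) (aut_map h).
Proof.
rewrite /aut_inv; case: cid => k /= [hk kh].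
by elim/boundary_ind => w; rewrite !aut_map_end; apply: way_eq => i /=; rewrite kh.
Qed.

Lemma branch_aut (h : aut) a b x : branch a b x -> branch (h a) (h b) (h x).
Proof.
move=> [p bp <-]; exists (map h p); last by rewrite last_map.
rewrite path_map; apply: sub_path bp => u v /=.
by rewrite /cut_adj /= !(bij_eq (aut_bij h)) aut_adj.
Qed.

Lemma ball_aut (h : aut) a b x : tree_ball a b x -> tree_ball (h a) (h b) (aut_map h x).
Proof.
move=> [w -> wab]; exists (way_map h w); first exact: aut_map_end.
by move=> i; exact: branch_aut.
Qed.

Lemma continuous_balls (f : boundary -> boundary) :
  (forall B, tree_balls B -> open (f @^-1` B)) -> continuous f.
Proof.
move=> fB x A /=; rewrite nbhsE => -[U [[BB sB <-] [C BC Cfx]] sUA].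
have [D sD CE] := sB _ BC.
suff : nbhs x (f @^-1` C).
  by apply: filterS => y fyC; apply: sUA; exists C.
rewrite -CE preimage_bigcap; apply: filter_bigI => E DE.
apply: open_nbhs_nbhs; split; first by apply: fB; move/sD : DE; rewrite inE.
by move: Cfx; rewrite -CE; exact.
Qed.

Lemma open_tree_ball a b : adj a b -> open (tree_ball a b).
Proof.
move=> ab; exists [set tree_ball a b]; last by rewrite bigcup_set1.
move=> _ ->; exists [fset tree_ball a b]%fset; last by rewrite set_fset1 bigcap_set1.
by move=> B /fset1P ->; apply/mem_set; exists a, b.
Qed.

Lemma aut_map_continuous (h : aut) : continuous (aut_map h).
Proof.
apply: continuous_balls => _ [a [b [ab ->]]].
rewrite (_ : _ @^-1` _ = tree_ball (aut_inv h a) (aut_inv h b)).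
  by apply: open_tree_ball; rewrite aut_adj.
apply/seteqP; split => x /=; last first.
  move=> /(ball_aut h); rewrite /aut_inv; case: cid => k /= [_ kh].
  by rewrite !kh.
by move=> /(ball_aut (aut_inv h)); rewrite aut_mapK.
Qed.

Definition spheromorphism (f : boundary -> boundary) : Prop :=
  [/\ continuous f,
      exists f' : boundary -> boundary,
        [/\ continuous f', cancel f f' & cancel f' f]
    & forall x : boundary, exists h : aut, \forall y \near x, f y = aut_map h y].

Record hier := Hier {
  hier_fun :> boundary -> boundary;
  hierP : spheromorphism hier_fun }.

HB.instance Definition _ := gen_eqMixin hier.
HB.instance Definition _ := gen_choiceMixin hier.

Lemma hier_eq (f g : hier) : f =1 g -> f = g.
Proof.
case: f g => [f fP] [g gP] /= /funext fg; rewrite -{}fg in gP *.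
by rewrite (Prop_irrelevance fP gP).
Qed.

Fact aut_spheromorphism (h : aut) : spheromorphism (aut_map h).
Proof.
split; first exact: aut_map_continuous.
- exists (aut_map (aut_inv h)); split.
  + exact: aut_map_continuous.
  + exact: aut_mapK.
  + exact: aut_mapVK.
- by move=> x; exists h; near=> y.
Unshelve. all: by end_near. Qed.

Definition hier_of_aut (h : aut) : hier := Hier (aut_spheromorphism h).

Fact spheromorphism_comp (f g : hier) : spheromorphism (f \o g).
Proof.
case: f g => [f [cf [f' [cf' ff' f'f]] lf]] [g [cg [g' [cg' gg' g'g]] lg]] /=.
split.
- by move=> x; apply: continuous_comp; [exact: cg|exact: cf].
- exists (g' \o f'); split.
  + by move=> x; apply: continuous_comp; [exact: cf'|exact: cg'].
  + by move=> x /=; rewrite ff' gg'.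
  + by move=> x /=; rewrite g'g f'f.
- move=> x; have [k gk] := lg x; have [h fh] := lf (g x).
  exists (aut_comp h k).
  have {}fh := cg x _ fh.
  by apply: filterS2 gk fh => y gy fgy; rewrite aut_map_comp /= -gy.
Qed.

Definition hier_mul (f g : hier) : hier := Hier (spheromorphism_comp f g).

Definition hier_one : hier := hier_of_aut aut_id.

Fact spheromorphism_inv (f : hier) :
  exists g : hier, cancel f g /\ cancel g f.
Proof.
case: f => [f [cf [g [cg fg gf]] lf]] /=.
suff gP : spheromorphism g by exists (Hier gP).
split => //; first by exists f.
move=> y; have [h fh] := lf (g y); exists (aut_inv h).
have {}fh := cg y _ fh.
apply: (@filterS _ (nbhs y) _ _ _ _ fh) => z.
by rewrite /= gf => zh; rewrite [in RHS]zh aut_mapK.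
Qed.

Definition hier_inv (f : hier) : hier := projT1 (cid (spheromorphism_inv f)).

Fact hier_mulA : associative hier_mul.
Proof. by move=> f g h; exact: hier_eq. Qed.

Fact hier_mul1 : left_id hier_one hier_mul.
Proof. by move=> f; apply: hier_eq => x /=; exact: aut_map_id. Qed.

Fact hier_1mul : right_id hier_one hier_mul.
Proof. by move=> f; apply: hier_eq => x /=; rewrite aut_map_id. Qed.

Fact hier_mulV : left_inverse hier_one hier_inv hier_mul.
Proof.
move=> f; apply: hier_eq => x /=; rewrite aut_map_id /hier_inv.
by case: cid => g /= [fg _].
Qed.

Fact hier_Vmul : right_inverse hier_one hier_inv hier_mul.
Proof.
move=> f; apply: hier_eq => x /=; rewrite aut_map_id /hier_inv.
by case: cid => g /= [_ gf].
Qed.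

HB.instance Definition _ :=
  isGroup.Build hier hier_mulA hier_mul1 hier_1mul hier_mulV hier_Vmul.

(** Aut(T_n) is to be an open subgroup carrying its own topology, whose
    neighborhoods of 1 are generated by the pointwise stabilizers of finite sets
    of vertices; hence these stabilizers also generate the neighborhoods of 1 in
    Hier(T_n), and their left translates those of the other points. *)
Definition hier_open (U : set hier) : Prop :=
  forall g, U g -> exists F : seq T, forall h : aut,
    {in F, forall v, h v = v} -> U (g * hier_of_aut h)%g.

Fact hier_openT : hier_open setT.
Proof. by move=> g _; exists [::]. Qed.

Fact hier_openI : setI_closed hier_open.
Proof.
move=> U W oU oW g [/oU[F FU] /oW[F' FW]]; exists (F ++ F') => h hF.
by split; [apply: FU|apply: FW] => v vF; apply: hF; rewrite mem_cat vF ?orbT.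
Qed.

Fact hier_open_bigU (I : Type) (U : I -> set hier) :
  (forall i, hier_open (U i)) -> hier_open (\bigcup_i U i).
Proof.
by move=> oU g [i _ /oU[F FU]]; exists F => h hF; exists i => //; exact: FU.
Qed.

HB.instance Definition _ :=
  isOpenTopological.Build hier hier_openT hier_openI hier_open_bigU.

Definition clop : set (set boundary) :=
  [set A | [/\ clopen A, A !=set0 & A <> setT]].

Definition clop_class (iota : nat) : set (set boundary) :=
  [set A | clop A /\ exists m (B : 'I_m -> set boundary),
     [/\ forall i, tree_balls (B i), trivIset setT B, A = \bigcup_i B i
       & (m = iota %[mod n.-1])%N]].

Definition is_aut_orbit (iota : nat) (O : set (set boundary)) : Prop :=
  exists2 A, clop_class iota A & O = [set hier_of_aut h @` A | h in setT].

(** [lift ord_max q] indexes the orbit [O q], and [ord_max] the complement of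
    the orbits. *)
Definition orbit_part (iota N : nat) (O : 'I_N -> set (set boundary))
    (p : 'I_N.+1) : set (set boundary) :=
  if unlift ord_max p is Some q then O q
  else clop_class iota `\` \bigcup_q O q.

Definition part_index (k : nat) (P : 'I_k.+1 -> set (set boundary))
    (A : set boundary) : 'I_k.+1 := xget ord_max [set p | P p A].

Definition moved (k : nat) (P : 'I_k -> set (set boundary)) (p q : 'I_k)
    (g : hier) : set (set boundary) :=
  [set A | P p A /\ P q (g @` A)].

End Tree.

Section Complexification.
Variables (R : realType) (V : lmodType R).
Local Open Scope complex_scope.

(** The pair [(u, v)] stands for u + i v. *)
Definition complexification : Type := (V * V)%type.

HB.instance Definition _ := GRing.Zmodule.copy complexification (V * V)%type.

Definition cscale (c : R[i]) (z : complexification) : complexification :=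
  let: a +i* b := c in (a *: z.1 - b *: z.2, b *: z.1 + a *: z.2).

Fact cscaleA a b z : cscale a (cscale b z) = cscale (a * b) z.
Proof.
case: a b z => [a a'] [b b'] [u v]; rewrite /cscale /=; congr pair.
  by rewrite scalerBr scalerDr scalerBl scalerDl !scalerA !opprD addrACA.
rewrite scalerBr scalerDr scalerBl scalerDl !scalerA addrACA.
by congr (_ + _); rewrite addrC.
Qed.

Fact cscale1 z : cscale 1 z = z.
Proof. by case: z => u v; rewrite /cscale /= !scale1r !scale0r subr0 add0r. Qed.

Fact cscaleDr : right_distributive cscale +%R.
Proof.
move=> [a b] [u v] [u' v']; rewrite /cscale /=.
by congr pair; rewrite !scalerDr ?opprD addrACA.
Qed.

Fact cscaleDl z : {morph cscale^~ z : a b / a + b}.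
Proof.
case: z => u v [a a'] [b b']; rewrite /cscale /=.
by congr pair; rewrite !scalerDl ?opprD addrACA.
Qed.

HB.instance Definition _ := GRing.Zmodule_isLmodule.Build R[i] complexification
  cscaleA cscale1 cscaleDr cscaleDl.

Definition complexify (u : V) : complexification := (u, 0).

Variable dot : {dot V for idfun}.

Definition cdot (z w : complexification) : R[i] :=
  (dot z.1 w.1 + dot z.2 w.2) +i* (dot z.2 w.1 - dot z.1 w.2).

Let dotC u v : dot u v = dot v u.
Proof. by rewrite hermitian_subproof expr0 mul1r. Qed.

Let dotDl w u v : dot (u + v) w = dot u w + dot v w.
Proof. exact: linearDl. Qed.

Let dotNl w u : dot (- u) w = - dot u w.
Proof. exact: linearNl. Qed.

Let dotZl w a u : dot (a *: u) w = a * dot u w.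
Proof. exact: linearZl_LR. Qed.

Fact cdot_hermitian z w : cdot z w = (-1) ^+ false * Num.conj (cdot w z).
Proof.
rewrite expr0 mul1r /cdot; apply/eqP; rewrite eq_complex /=; apply/andP.
split; apply/eqP; first by rewrite dotC [dot z.2 _]dotC.
by rewrite opprB dotC [dot z.1 _]dotC.
Qed.

Fact cdot_linearl w : linear_for *%R (cdot^~ w).
Proof.
move=> [a b] [u v] [u' v']; rewrite /cdot /=; apply/eqP; rewrite eq_complex /=.
rewrite !(dotDl, dotNl, dotZl); apply/andP; split; apply/eqP; ring.
Qed.

Fact cdot_linearr z : linear_for (Num.conj \; *%R) (cdot z).
Proof.
move=> c w w'; rewrite cdot_hermitian cdot_linearl rmorphD rmorphM /=.
by rewrite expr0 !mul1r [cdot z w]cdot_hermitian [cdot z w']cdot_hermitian !mul1r.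
Qed.

HB.instance Definition _ := bilinear_isBilinear.Build R[i] complexification
  complexification R[i] *%R (Num.conj \; *%R) cdot (cdot_linearl, cdot_linearr).

HB.instance Definition _ := isHermitianSesquilinear.Build R[i] complexification
  false Num.conj cdot cdot_hermitian.

Fact cdot_gt0 z : z != 0 -> 0 < cdot z z.
Proof.
have dot_ge0 u : 0 <= dot u u.
  have [->|u0] := eqVneq u 0; first by rewrite linear0l.
  exact/ltW/neq0_dnorm_gt0.
case: z => u v uv0; rewrite ltcE /= dotC subrr eqxx /=.
have [u0|u0] := eqVneq u 0; last by rewrite ltr_wpDr ?neq0_dnorm_gt0.
rewrite u0 linear0l add0r neq0_dnorm_gt0//.
by apply: contraNneq uv0 => v0; rewrite u0 v0.
Qed.

HB.instance Definition _ := isDotProduct.Build R[i] complexification cdot cdot_gt0.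

End Complexification.

Record hilbertSpace (R : realType) := HilbertSpace {
  hilbert_sort :> completeNormedModType R[i];
  hdot : {dot hilbert_sort for Num.conj};
  hdot_norm : forall x, `|x| ^+ 2 = hdot x x }.

Arguments hdot {R} h : rename.

Definition lin_span (K : nzRingType) (E : lmodType K) (A : set E) : set E :=
  [set x | exists m (c : 'I_m -> K) (v : 'I_m -> E),
     (forall i, A (v i)) /\ x = \sum_i c i *: v i].

Section Representations.
Variables (R : realType) (n : nat) (T : regTree n) (H : hilbertSpace R).
Variable rho : hier T -> H -> H.

Definition unitary_rep : Prop :=
  [/\ forall g, linear (rho g),
      forall g x y, hdot H (rho g x) (rho g y) = hdot H x y,
      forall x, rho 1%g x = x,
      forall g h x, rho (g * h)%g x = rho g (rho h x)
    & forall x, continuous (fun g => rho g x)].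

Definition closed_subspace (W : set H) : Prop :=
  [/\ closed W, W 0 & forall a x y, W x -> W y -> W (a *: x + y)].

Definition invariant (W : set H) : Prop := forall g x, W x -> W (rho g x).

Definition fixed_by (K : set (hier T)) (v : H) : Prop :=
  forall g, K g -> rho g v = v.

Definition cyclic_span (v : H) : set H := closure (lin_span (range (rho^~ v))).

(** Representations restricted to a subspace [W] are described inside [H]. *)
Definition irreducible_on (W : set H) : Prop :=
  [/\ closed_subspace W, invariant W, exists2 x, W x & x != 0
    & forall W', closed_subspace W' -> invariant W' -> W' `<=` W ->
        W' = [set 0] \/ W' = W].

Definition spherical_on (K : set (hier T)) (W : set H) (v : H) : Prop :=
  irreducible_on W /\
  [/\ W v, v != 0, fixed_by K v
    & forall w, W w -> fixed_by K w -> exists c, w = c *: v].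

Definition spherical_function (v : H) (g : hier T) : R[i] := hdot H (rho g v) v.

End Representations.

Section Tensor.
Variables (R : realType) (J : choiceType) (D : set J) (E : J -> lmodType R[i]).
Variables (ip : forall j, {dot E j for Num.conj}) (xi : forall j, E j).

Definition almost_xi (x : forall j, E j) : Prop :=
  finite_set [set j | D j /\ x j <> xi j].

(** [H], with the vectors [tau x] for the [\otimes_(j \in D) x j], is the
    completion of the span of these vectors. Only the components of [x] on [D]
    matter; that [tau] is multilinear follows from the formula for the inner
    product, in which all but finitely many factors are [ip j (xi j) (xi j) = 1]. *)
Definition is_tensor_product (H : hilbertSpace R)
    (tau : (forall j, E j) -> H) : Prop :=
  (forall x y, almost_xi x -> almost_xi y ->
     hdot H (tau x) (tau y) = \big[*%R/1]_(j \in D) ip j (x j) (y j)) /\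
  closure (lin_span [set tau x | x in almost_xi]) = setT.

End Tensor.

(** The vector in the factor with index [g A] of the image under [g] is the
    vector that was in the factor with index [A]. *)
Definition permute_factors (n : nat) (T : regTree n) (E : Type) (g : hier T)
    (x : set (boundary T) -> E) : set (boundary T) -> E :=
  fun A => x (g @^-1` A).

(** [None] stands for an infinite number. *)
Definition set_count (I : choiceType) (A : set I) : option nat :=
  if `[< finite_set A >] then Some #|` fset_set A|%fset else None.

(** [0 ^+ 0 = 1], and an infinite exponent only occurs for [s = 1]. *)
Definition pow_count (R : realType) (s : R) (m : option nat) : R :=
  if m is Some m' then s ^+ m' else (s == 1)%:R.

Definition theta (n : nat) (T : regTree n) (k : nat)
    (P : 'I_k -> set (set (boundary T))) (p q : 'I_k) (g : hier T) : option nat :=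
  set_count (moved P p q g).

(* Main.v *)
Require Import Defs.
From HB Require Import structures.
From mathcomp Require Import all_boot all_order all_algebra.
From mathcomp Require Import finmap complex zify.
From mathcomp Require Import all_classical reals topology normedtype.

Set Implicit Arguments.
Unset Strict Implicit.
Unset Printing Implicit Defensive.

Import Order.TTheory GRing.Theory Num.Theory.
Import numFieldNormedType.Exports.

Local Open Scope classical_set_scope.
Local Open Scope ring_scope.

(** A spheromorphism coincides with an automorphism on each of finitely many balls
    covering the boundary. If [A] is the image of a fixed clopen set under an
    automorphism moving a base vertex far away, then [A] or its complement lies in
    one of these balls, so [g A] stays in the [Aut]-orbit of [A]: only finitely many
    members of an orbit leave it. Hence the permutation of the factors preserves the
    set of almost distinguished families, and extends to a unitary operator.

    Since [T] is vertex-transitive, every finite family of clopen sets has infinitely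
    many pairwise disjoint translates by automorphisms. Therefore the translates of
    [y - <y, E> E], for [y] in the span of the decomposable vectors, can be made
    pairwise orthogonal, and suitable averages of [rho h x], [h] in [Aut], tend to
    [<x, E> E]. This shows at once that [E] spans the [Aut]-fixed vectors and that a
    closed invariant subspace of the cyclic span of [E] contains [E] or is
    orthogonal to it. *)

(** * Distance in a regular tree *)

(** Tree geometry is reduced to integer arithmetic on distances. Adjacent vertices are never
    equidistant from a third one, and a way ends by moving straight away from any given vertex, so
    whether its end lies in a ball is decided by comparing two distances at one vertex of the way.
    The obstacle to separating translates is that a clopen set has many descriptions by edges. It is
    overcome by observing that a set described from both ends of a path of two edges is empty or
    everything as soon as the middle vertex has a third neighbour; this uses [n >= 2]. The tensor
    product sees the partition only through the family [xi] of unit vectors, which is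
    [Aut]-invariant and is changed by each [g] at finitely many indices. For the complement of the
    orbits this finiteness comes from the orbits, applied to [g^-1]. *)

Section Distance.
Variables (n : nat) (T : regTree n).
Implicit Types (x y z a b u v : T) (p q : seq T).
Local Open Scope nat_scope.

(** Cut [p] at its first vertex [s] on [q]: the two arcs from [x] to [s] meet only at their ends and
    close up to a simple cycle with [size p1 + size q1 + 2] vertices. Acyclicity allows at most two,
    so both arcs are the single edge from [x] to [s]. *)
Lemma fork_head x p q : path (@adj n T) x p -> path (@adj n T) x q ->
  uniq (x :: p) -> uniq (x :: q) -> has (mem q) p -> head x p = head x q.
Proof.
move=> xp xq /= /andP[xNp up] /andP[xNq uq] pq.
case/split_find: pq xp up xNp => s p1 p2 /= sq p1q xp up xNp.
case/splitPr: sq xq uq xNq p1q => q1 q2 xq uq xNq p1q.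
have cyc : ucycle (@adj n T) (x :: p1 ++ s :: rev q1).
  apply/andP; split.
    rewrite /cycle -cats1 -catA cat_path.
    move: xp; rewrite -cats1 -catA cat_path /= => /and3P[-> -> _] /=.
    rewrite cats1 -rev_cons -(belast_rcons x q1 s).
    rewrite -[X in path _ X (rev _)](last_rcons x q1) rev_path.
    move: xq; rewrite -cat_rcons cat_path => /andP[+ _].
    by apply: sub_path => u v; rewrite adj_sym.
  have : uniq (rcons p1 s) by move: up; rewrite cat_uniq => /andP[].
  have : uniq (rcons q1 s) by move: uq; rewrite -cat_rcons cat_uniq => /andP[].
  have : x \notin rcons p1 s by move: xNp; rewrite mem_cat negb_or => /andP[].
  have : x \notin rcons q1 s.
    by move: xNq; rewrite -cat_rcons mem_cat negb_or => /andP[].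
  rewrite !rcons_uniq !mem_rcons !inE !negb_or.
  move=> /andP[-> xq1] /andP[_ xp1] /andP[sq1 uq1] /andP[sp1 up1].
  rewrite /= mem_cat inE mem_rev !negb_or cat_uniq /= mem_rev rev_uniq.
  move: xNp; rewrite mem_cat mem_rcons inE !negb_or => /andP[/andP[-> _] _].
  rewrite xq1 xp1 up1 sq1 uq1 (negPf sp1) /= andbT.
  apply/hasPn => u; rewrite mem_rev => uq1'.
  by apply: contra p1q => up1'; apply/hasP; exists u => //=; rewrite mem_cat uq1'.
have := tree_acyclic cyc; rewrite /= size_cat /= size_rev.
by case: p1 q1 {cyc xp up xNp xq uq xNq p1q} => [|? ?] [|? ?] //=; lia.
Qed.

Lemma simple_path_unique x p q :
  path (@adj n T) x p -> path (@adj n T) x q -> uniq (x :: p) -> uniq (x :: q) ->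
  last x p = last x q -> p = q.
Proof.
elim: p x q => [|y p IH] x [|z q] //.
- by move=> _ _ _ /= /andP[xq _] xE; rewrite xE mem_last in xq.
- by move=> _ _ /= /andP[xp _] _ xE; rewrite -xE mem_last in xp.
move=> xp xq up uq lpq.
have : has (mem (z :: q)) (y :: p).
  apply/hasP; exists (last y p); first exact: mem_last.
  by rewrite (lpq : last y p = last z q); exact: mem_last.
move=> /(fork_head xp xq up uq) /= yz; rewrite -{z}yz in xq uq lpq *.
move: xp xq up uq => /= /andP[_ xp] /andP[_ xq] /andP[_ up] /andP[_ uq].
by rewrite (IH _ _ xp xq).
Qed.

Lemma simple_path_ex x y :
  exists p, [/\ path (@adj n T) x p, uniq (x :: p) & last x p = y].
Proof.
have [p xp <-] := tree_connected x y.
by case/shortenP: xp => q xq uq _; exists q.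
Qed.

Definition geodesic x y : seq T := projT1 (cid (simple_path_ex x y)).

Lemma geodesicP x y :
  [/\ path (@adj n T) x (geodesic x y), uniq (x :: geodesic x y)
    & last x (geodesic x y) = y].
Proof. by rewrite /geodesic; case: cid. Qed.

Lemma geodesicE x p : path (@adj n T) x p -> uniq (x :: p) -> geodesic x (last x p) = p.
Proof.
move=> xp up; have [xq uq lq] := geodesicP x (last x p).
exact: simple_path_unique xq xp uq up lq.
Qed.

Definition dist x y := size (geodesic x y).

Lemma dist_path x p : path (@adj n T) x p -> uniq (x :: p) -> dist x (last x p) = size p.
Proof. by move=> xp up; rewrite /dist (geodesicE xp up). Qed.

Lemma distxx x : dist x x = 0.
Proof. exact: (@dist_path x [::]). Qed.

Lemma dist_eq0 x y : (dist x y == 0) = (x == y).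
Proof.
apply/eqP/eqP => [|->]; last exact: distxx.
by move=> /size0nil E; have [_ _] := geodesicP x y; rewrite E.
Qed.

Lemma adj_neq x y : adj x y -> x != y.
Proof. by apply: contraTneq => ->; rewrite adj_irr. Qed.

Lemma dist_adj x y : adj x y -> dist x y = 1.
Proof.
move=> xy; apply: (@dist_path x [:: y]); rewrite /= ?xy//.
by rewrite inE adj_neq.
Qed.

Lemma geodesic_rev x y : geodesic y x = rev (belast x (geodesic x y)).
Proof.
have [xp up <-] := geodesicP x y; rewrite geodesicE//.
set p := geodesic x y in xp up *.
rewrite -[X in geodesic _ X](_ : last (last x p) (rev (belast x p)) = x).
  apply: geodesicE.
    by rewrite rev_path; apply: sub_path xp => u v; rewrite adj_sym.
  by rewrite -rev_rcons -lastI rev_uniq.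
by case: p {xp up} => //= z p; rewrite rev_cons last_rcons.
Qed.

Lemma dist_sym x y : dist x y = dist y x.
Proof. by rewrite /dist (geodesic_rev x y) size_rev size_belast. Qed.

Lemma geodesic_closer x y z : adj x y ->
  (geodesic x z = y :: geodesic y z) \/ (geodesic y z = x :: geodesic x z).
Proof.
move=> xy; have [xp up lp] := geodesicP x z.
have [yp|yp] := boolP (y \in geodesic x z); last first.
  right; rewrite -[in LHS]lp (_ : last x _ = last y (x :: geodesic x z))//.
  rewrite geodesicE//=; first by rewrite adj_sym xy.
  by rewrite inE negb_or yp eq_sym adj_neq//= in up *.
left; move: xp up lp; case/splitPr: yp => p1 p2 xp up lp.
move: (xp); rewrite -cat_rcons cat_path last_rcons => /andP[xp1 yp2].
move: (up); rewrite -cat_rcons -cat_cons cat_uniq => /and3P[up1 _ up2].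
have : rcons p1 y = [:: y].
  apply: simple_path_unique xp1 _ up1 _ _; rewrite ?last_rcons//= ?xy//.
  by rewrite inE adj_neq.
case: p1 xp up lp {xp1 up1} => [|u [|? ?]] //= xp up lp _.
by rewrite -lp geodesicE//; case/andP: up.
Qed.

Lemma geodesic_rcons r x y : adj x y ->
  geodesic r y = rcons (geodesic r x) y \/ geodesic r x = rcons (geodesic r y) x.
Proof.
move=> /geodesic_closer -/(_ r)[] E; [right|left];
  by rewrite (geodesic_rev _ r) E /= rev_cons -geodesic_rev.
Qed.

(** A tree is bipartite, so adjacent vertices are never equidistant from [z]. Many later
    inequalities between distances follow from this alternative by linear arithmetic. *)
Lemma dist_step x y z : adj x y -> dist x z = (dist y z).+1 \/ dist y z = (dist x z).+1.
Proof. by move=> /geodesic_closer -/(_ z)[] E; [left|right]; rewrite /dist E. Qed.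

Lemma dist_next x z : x != z -> exists2 y, adj x y & dist x z = (dist y z).+1.
Proof.
have := geodesicP x z; rewrite /dist; case E : (geodesic x z) => [|y p] [xp up lp].
  by rewrite -lp /= eqxx.
move: xp => /= /andP[xy yp] _; exists y => //.
have [|E'] := geodesic_closer z xy; first by rewrite E => -[->].
have [_ uq _] := geodesicP y z; rewrite E' E in uq.
by move: uq; rewrite /= !inE eqxx !orbT.
Qed.

Lemma dist_next_unique x y y' z : adj x y -> adj x y' ->
  dist y z < dist x z -> dist y' z < dist x z -> y = y'.
Proof.
move=> xy xy'; rewrite /dist.
have [E|->] := geodesic_closer z xy; last by rewrite /= ltnNge leqW.
have [E'|->] := geodesic_closer z xy'; last by move=> /= _; rewrite ltnNge leqW.
by move: E'; rewrite E => -[].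
Qed.

Lemma dist_triangle y x z : dist x z <= dist x y + dist y z.
Proof.
have [m] := ubnP (dist x y); elim: m x => // m IH x.
have [->|xy] := eqVneq x y; first by rewrite distxx.
have [u xu du] := dist_next xy.
have := dist_step z xu; have := IH u; lia.
Qed.

Lemma adj_dist x y : adj x y = (dist x y == 1).
Proof.
apply/idP/eqP => [/dist_adj//|xy].
have [|z xz] := @dist_next x y; first by rewrite -dist_eq0 xy.
by rewrite xy => -[/esym/eqP]; rewrite dist_eq0 => /eqP <-.
Qed.

Lemma aut_dist (h : aut T) x y : dist (h x) (h y) = dist x y.
Proof.
have [xp up lp] := geodesicP x y; rewrite -[in LHS]lp -last_map dist_path ?size_map//.
  by rewrite path_map; apply: sub_path xp => u v /=; rewrite aut_adj.
by rewrite -map_cons map_inj_uniq//; exact: bij_inj (aut_bij h).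
Qed.

(** Turns the connected component of the definition into a comparison of distances. An edge joining
    the two sides of the comparison can only be [{a, b}], so a path avoiding it stays on its side;
    conversely a vertex on the side of [b] can step towards [b] without leaving that side. *)
Lemma branch_dist a b x : adj a b -> branch a b x <-> dist b x < dist a x.
Proof.
move=> ab; split.
  move=> [p]; elim/last_ind: p x => [|p u IH] x.
    by move=> _ <-; rewrite /= distxx dist_adj.
  rewrite rcons_path last_rcons => /andP[/IH/(_ erefl)].
  move: (last b p) => {}v vb + <- {x p IH}; rewrite /cut_adj => /andP[vu].
  apply: contraNltn => uab.
  suff vE : v = b.
    rewrite vE !eqxx /=; suff -> : u = a by rewrite eqxx orbT.
    apply/eqP; rewrite eq_sym -dist_eq0; rewrite vE distxx in vb.
    have := dist_step a vu; have := dist_adj ab; have := dist_adj vu.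
    rewrite vE (dist_sym u) (dist_sym b a). rewrite (dist_sym b u) in uab *. 
    move: uab; rewrite (dist_sym u b); lia.
  apply/eqP; apply: contraTT isT => /eqP; move/eqP => vNb.
  have [t vt dt] := dist_next vNb.
  have av := dist_step v ab; have au := dist_step u ab.
  have := dist_step a vu; have := dist_step b vu.
  have := dist_triangle b t a; rewrite (dist_sym b a) (dist_adj ab).
  rewrite !(dist_sym a) !(dist_sym b) in vb uab av au * => tr dvb dva.
  have tu : t = u.
    by apply: (dist_next_unique (x := v) (z := a)) => //; lia.
  rewrite tu in dt; lia.
have [m] := ubnP (dist b x); elim: m x => // m IH x mx abx.
have [->|xb] := eqVneq x b; first by exists [::].
have [t xt dt] := dist_next xb.
have tab : dist b t < dist a t.
  have := dist_step a xt; move: dt abx.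
  rewrite (dist_sym x a) (dist_sym t a) (dist_sym x b) (dist_sym t b) => *; lia.
have [|p bp lp] := IH _ _ tab; first by move: mx; rewrite !(dist_sym b); lia.
exists (rcons p x); rewrite ?last_rcons// rcons_path bp lp /= /cut_adj adj_sym xt /=.
by apply/negP => /orP[] /andP[/eqP tE /eqP xE]; move: tab abx; rewrite tE xE !distxx ?ltn0.
Qed.

End Distance.

(** * Branches, balls and the eventual behaviour of ways *)

Section Branches.
Variables (n : nat) (T : regTree n).
Implicit Types (x y z a b c d u v : T) (w : way T) (F : seq T).
Local Open Scope nat_scope.

Lemma dist_ltnN a b x : adj a b -> (dist b x < dist a x) = ~~ (dist a x < dist b x).
Proof. by move=> /dist_step -/(_ x); lia. Qed.

(** The geodesic between the two sides runs through the edge. Stepping from [u] to its neighbour [t]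
    towards [a] also approaches [v]: otherwise [u] would be the neighbour of [t] towards [v], which
    is the one towards [a], or [b] itself if [t] is [a]. *)
Lemma dist_across a b u v : adj a b -> dist a u < dist b u -> dist b v < dist a v ->
  dist u v = (dist u a + dist b v).+1.
Proof.
move=> ab; have [m] := ubnP (dist u a); elim: m u => // m IH u um au bv.
have [uE|uNa] := eqVneq u a.
  by rewrite uE distxx add0n; have := dist_step v ab; lia.
have [t ut dt] := dist_next uNa.
have at_ : dist a t < dist b t.
  move: dt au (dist_step b ut).
  rewrite (dist_sym u a) (dist_sym t a) (dist_sym u b) (dist_sym t b) => *; lia.
have tv : dist t v = (dist t a + dist b v).+1 by apply: IH => //; lia.
have [|uv] := dist_step v ut; first by lia.
have tu : adj t u by rewrite adj_sym.
have [tE|tNa] := eqVneq t a.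
  rewrite tE in tu uv; have uE : u = b.
    by apply: (dist_next_unique (x := a) (z := v)) => //; rewrite uv.
  by rewrite uE distxx in au.
have [s ts ds] := dist_next tNa.
have sE : s = u.
  apply: (dist_next_unique (x := t) (z := v)) => //; last by rewrite uv.
  have := dist_triangle a s v; have := dist_step v ab; lia.
by rewrite sE in ds; lia.
Qed.

Lemma branch_sub a b c d v : adj a b -> adj c d ->
  dist b c < dist a c -> dist b d < dist a d -> dist a c < dist a d ->
  dist d v < dist c v -> dist b v < dist a v.
Proof.
move=> ab cd bc bd acd dv; rewrite dist_ltnN//; apply/negP => av.
have vc := dist_across ab av bc; have vd := dist_across ab av bd.
have := dist_step c ab; have := dist_step d ab.
by rewrite !(dist_sym _ v) in dv *; lia.
Qed.

Lemma branch_near a b u v : adj a b -> dist b u < dist a u -> dist u v <= dist b u ->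
  dist b v < dist a v.
Proof.
move=> ab bu uv; rewrite dist_ltnN//; apply/negP => av.
by have := dist_across ab av bu; rewrite dist_sym; lia.
Qed.

Lemma neighbours_ex x : exists s : seq T,
  [/\ uniq s, size s = n.+1 & forall y, (y \in s) = adj x y].
Proof.
have xn := tree_regular x.
have fx : finite_set [set y | adj x y].
  by apply/finite_setP; exists n.+1.
exists (enum_fset (fset_set [set y | adj x y])); split.
- exact: fset_uniq.
- exact: card_fset_set.
- move=> y; rewrite -[LHS]/(y \in fset_set _) in_fset_set//.
  by apply/idP/idP => [/set_mem|yx]//; exact/mem_set.
Qed.

Definition neighbours x : seq T := projT1 (cid (neighbours_ex x)).

Lemma neighbours_uniq x : uniq (neighbours x).
Proof. by rewrite /neighbours; case: cid => s []. Qed.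

Lemma size_neighbours x : size (neighbours x) = n.+1.
Proof. by rewrite /neighbours; case: cid => s []. Qed.

Lemma mem_neighbours x y : (y \in neighbours x) = adj x y.
Proof. by rewrite /neighbours; case: cid => s []. Qed.

Lemma neighbour_avoid x F : (size F <= n) -> exists2 y, adj x y & y \notin F.
Proof.
move=> Fn; have : ~~ all (mem F) (neighbours x).
  apply/negP => /allP /(uniq_leq_size (neighbours_uniq x)).
  by rewrite size_neighbours ltnNge Fn.
by case/allPn => y yx yF; exists y; rewrite // -mem_neighbours.
Qed.

Lemma finite_dist_ball x R : exists F, forall y, dist x y <= R -> y \in F.
Proof.
elim: R => [|R [F IH]].
  by exists [:: x] => y; rewrite leqn0 dist_eq0 inE eq_sym.
exists (x :: flatten (map neighbours F)) => y xy; rewrite inE.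
have [//|yx/=] := eqVneq y x.
have [z yz dyz] := dist_next yx; apply/flatten_mapP; exists z.
  by apply: IH; move: dyz xy; rewrite !(dist_sym x) => ->.
by rewrite mem_neighbours adj_sym.
Qed.

(** From index [i] on, the way moves straight away from [z]. Every way does so eventually, and from
    then on its position relative to [z] is known. *)
Definition settled w z i := forall k, dist z (w (i + k)) = dist z (w i) + k.

Lemma settled_add w z i j : settled w z i -> settled w z (i + j).
Proof. by move=> wz k; rewrite -addnA !wz addnA. Qed.

(** After a step away from [z], the only neighbour closer to [z] is the vertex just left, and
    returning there would be backtracking. *)
Lemma settled_step w z i : dist z (w i) < dist z (w i.+1) -> settled w z i.
Proof.
move=> wi k.
suff : dist z (w (i + k)) = dist z (w i) + k /\
       dist z (w (i + k)) < dist z (w (i + k).+1) by case.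
elim: k => [|k [IH IH']]; first by rewrite !addn0.
have := dist_step z (way_adj w (i + k)).
have aw := way_adj w (i + k).+1.
rewrite addnS; split.
  by move: (dist_step z (way_adj w (i + k))) IH IH'; rewrite !(dist_sym z) => *; lia.
have := dist_step z aw; rewrite !(dist_sym _ z) => -[h|->//].
have := way_nonbacktracking w (i + k); rewrite (_ : w (i + k) = w (i + k).+2) ?eqxx//.
apply: (dist_next_unique _ aw (z := z)).
- by rewrite adj_sym way_adj.
- by rewrite !(dist_sym _ z).
- by rewrite !(dist_sym _ z); lia.
Qed.

Lemma settled_ex w z : exists i, settled w z i.
Proof.
suff H m : forall i, dist z (w i) < m -> exists i, settled w z i.
  exact: (H (dist z (w 0)).+1 0 (ltnSn _)).
elim: m => // m IH i im.
have [lt|ge] := ltnP (dist z (w i)) (dist z (w i.+1)).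
  by exists i; exact: settled_step.
apply: (IH i.+1); have := dist_step z (way_adj w i); rewrite !(dist_sym _ z) => *; lia.
Qed.

Lemma settled_seq w F : exists i, {in F, forall z, settled w z i}.
Proof.
elim: F => [|z F [i IH]]; first by exists 0.
have [j zj] := settled_ex w z; exists (i + j) => u; rewrite inE => /orP[/eqP ->|uF].
  by rewrite addnC; exact: settled_add.
by apply: settled_add; exact: IH.
Qed.

(** Once both distances grow by one at each step, their comparison no longer changes, so a single
    vertex decides. Conversely the tail of [w] from [i] is a way inside the branch, and [tree_ball]
    asks for some representative only. *)
Lemma mem_ball w a b i : adj a b -> settled w a i -> settled w b i ->
  tree_ball a b (way_end w) <-> dist b (w i) < dist a (w i).
Proof.
move=> ab wa wb; split.
  move=> [w' /eqmodP/asboolP[k [l kl]]] w'ab.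
  have := w'ab (l + i); rewrite -kl branch_dist// addnC wa wb => *; lia.
move=> bi; have adj' j : adj (w (i + j)) (w (i + j.+1)) by rewrite addnS way_adj.
have nb j : w (i + j) != w (i + j.+2) by rewrite !addnS way_nonbacktracking.
exists (Way adj' nb).
  by apply/eqmodP/asboolP; exists i, 0.
by move=> j; rewrite /= branch_dist// wa wb; lia.
Qed.

Lemma ballC a b : adj a b -> tree_ball b a = ~` tree_ball a b.
Proof.
move=> ab; have ba : adj b a by rewrite adj_sym.
apply/seteqP; split; elim/boundary_ind => w;
  have [i wi] := settled_seq w [:: a; b];
  have wa : settled w a i by [apply: wi; rewrite inE eqxx];
  have wb : settled w b i by [apply: wi; rewrite !inE eqxx orbT];
  rewrite /= (mem_ball ab wa wb) (mem_ball ba wb wa) (dist_ltnN _ ab).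
  by move=> ->.
by move/negP; rewrite negbK.
Qed.

Lemma ball_sub a b c d : adj a b -> adj c d ->
  dist b c < dist a c -> dist b d < dist a d -> dist a c < dist a d ->
  tree_ball c d `<=` tree_ball a b.
Proof.
move=> ab cd bc bd acd x [w -> wcd]; exists w => // i.
have := wcd i; rewrite !branch_dist//.
exact: branch_sub.
Qed.

(** Together with [children_disjoint] this cuts a ball into [n] disjoint balls, the move that
    changes a number of balls by [n - 1]. *)
Lemma ball_children a b (x : boundary T) : adj a b ->
  tree_ball a b x <-> exists2 c, adj b c /\ c != a & tree_ball b c x.
Proof.
move=> ab; elim/boundary_ind: x => w.
have [i wi] := settled_seq w (a :: b :: neighbours b).
have wa : settled w a i by apply: wi; rewrite inE eqxx.
have wb : settled w b i by apply: wi; rewrite !inE eqxx orbT.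
have wc c : adj b c -> settled w c i.
  by move=> bc; apply: wi; rewrite !inE mem_neighbours bc !orbT.
rewrite (mem_ball ab wa wb); split; last first.
  move=> [c [bc cNa]]; rewrite (mem_ball bc)//; last exact: wc.
  move=> cw; rewrite dist_ltnN//; apply: contraNN cNa => aw.
  by apply/eqP; apply: (dist_next_unique bc _ cw aw); rewrite adj_sym.
(* [w i] may be equal to [b], but [w i.+1] is not *)
move=> bw; have wiNb : b != w i.+1.
  by rewrite -dist_eq0 -addn1 wb addn1.
have [c bc dc] := dist_next wiNb.
exists c; first split => //.
  apply: contraTneq bw => ca; rewrite -ca in ab wa *.
  by move: dc; rewrite -addn1 wb wa => *; lia.
rewrite (mem_ball bc)//; last exact: wc.
by move: dc; rewrite -addn1 wb (wc _ bc) => *; lia.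
Qed.

Lemma children_disjoint b c c' (x : boundary T) : adj b c -> adj b c' ->
  tree_ball b c x -> tree_ball b c' x -> c = c'.
Proof.
move=> bc bc'; elim/boundary_ind: x => w.
have [i wi] := settled_seq w [:: b; c; c'].
have wb : settled w b i by apply: wi; rewrite !inE eqxx.
have wc : settled w c i by apply: wi; rewrite !inE eqxx ?orbT.
have wc' : settled w c' i by apply: wi; rewrite !inE eqxx ?orbT.
rewrite (mem_ball bc)// (mem_ball bc')//.
exact: dist_next_unique.
Qed.

Lemma way_choose (Q : T -> T -> Prop) a b :
  (forall x y, adj x y -> Q x y -> exists z, [/\ adj y z, z != x & Q y z]) ->
  adj a b -> Q a b ->
  exists w, [/\ w 0 = a, w 1 = b & forall i, Q (w i) (w i.+1)].
Proof.
move=> Qnext ab Qab.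
have nx (e : T * T) : exists z, adj e.1 e.2 -> Q e.1 e.2 ->
    [/\ adj e.2 z, z != e.1 & Q e.2 z].
  have [[eadj Qe]|nQ] := pselect (adj e.1 e.2 /\ Q e.1 e.2).
    by have [z ?] := Qnext _ _ eadj Qe; exists z.
  by exists e.1 => eadj Qe; case: nQ.
pose step (e : T * T) := (e.2, projT1 (cid (nx e))).
pose e i := iter i step (a, b).
have eP i : adj (e i).1 (e i).2 /\ Q (e i).1 (e i).2.
  elim: i => [|i [eadj Qe]] //; rewrite [e _](_ : _ = step (e i))//.
  by rewrite /step /=; case: cid => /= z /(_ eadj Qe)[].
have eadj i : adj (e i).1 (e i.+1).1 by case: (eP i).
have enb i : (e i).1 != (e i.+2).1.
  have [eiadj Qe] := eP i; rewrite [(e _.+2).1](_ : _ = projT1 (cid (nx (e i))))//.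
  by case: cid => /= z /(_ eiadj Qe)[_]; rewrite eq_sym.
by exists (Way eadj enb); split => // i; case: (eP i).
Qed.

Hypothesis n_gt0 : 0 < n.

Lemma way_ex a b : adj a b -> exists w, w 0 = a /\ w 1 = b.
Proof.
move=> ab; have [|w [w0 w1 _]] := @way_choose (fun _ _ => True) a b _ ab I.
  move=> x y _ _; have [z yz] := @neighbour_avoid y [:: x] n_gt0.
  by rewrite inE => zx; exists z.
by exists w.
Qed.

Lemma ball_neq0 a b : adj a b -> tree_ball a b !=set0.
Proof.
move=> ab; have [w [w0 w1]] := way_ex ab; exists (way_end w).
have wa : settled w a 1.
  by apply: (@settled_add _ _ 0); apply: settled_step; rewrite w0 w1 distxx dist_adj.
have wb : settled w b 1.
  by apply: settled_step; rewrite w1 distxx -w1 dist_adj// way_adj.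
by rewrite (mem_ball ab wa wb) w1 distxx dist_adj.
Qed.

End Branches.

(** * Vertex-transitivity of the automorphism group *)

Section Transitivity.
Variables (n : nat) (T : regTree n).
Implicit Types x y z p r : T.
Local Open Scope nat_scope.

(** Injectivity on stars forbids backtracking of the image of a geodesic, and in a tree a path
    without backtracking is a geodesic. *)
Lemma local_inj_dist (h : T -> T) :
  (forall x y, adj x y -> adj (h x) (h y)) ->
  (forall x y y', adj x y -> adj x y' -> h y = h y' -> y = y') ->
  forall x y, dist (h x) (h y) = dist x y.
Proof.
move=> hadj hinj x y; have [m] := ubnP (dist x y); elim: m x => // m IH x xm.
have [->|xy] := eqVneq x y; first by rewrite !distxx.
have [z xz dz] := dist_next xy.
have hz : dist (h z) (h y) = dist z y by apply: IH; lia.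
have [|hzx] := dist_step (h y) (hadj _ _ xz); first by rewrite hz dz.
have [zy|zy] := eqVneq z y; first by rewrite hzx zy distxx in hz.
have [u zu du] := dist_next zy.
have hu : dist (h u) (h y) = dist u y by apply: IH; lia.
have zx : adj z x by rewrite adj_sym.
have xu : x = u.
  apply: (hinj z) => //; apply: (dist_next_unique (x := h z) (z := h y)); try lia.
  - exact: hadj.
  - exact: hadj.
by rewrite xu in dz; lia.
Qed.

(** All stars have [n.+1] vertices, so [h] maps each star onto the star of the image. Surjectivity
    follows by lifting the path from a vertex to [h r] one edge at a time. *)
Lemma local_bij_aut (h : T -> T) :
  (forall x y, adj x y -> adj (h x) (h y)) ->
  (forall x y y', adj x y -> adj x y' -> h y = h y' -> y = y') ->
  exists k : aut T, k =1 h.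
Proof.
move=> hadj hinj; have hdist := local_inj_dist hadj hinj.
have injh : injective h.
  by move=> x y /eqP; rewrite -dist_eq0 hdist dist_eq0 => /eqP.
have hnext x z : adj (h x) z -> exists2 y, adj x y & h y = z.
  move=> xz; suff : z \in map h (neighbours x).
    by case/mapP => y; rewrite mem_neighbours => xy ->; exists y.
  have sub : {subset map h (neighbours x) <= neighbours (h x)}.
    by move=> _ /mapP[y + ->]; rewrite !mem_neighbours; exact: hadj.
  have [||_ ->] := uniq_min_size _ sub; last by rewrite mem_neighbours.
    by rewrite map_inj_uniq// neighbours_uniq.
  by rewrite size_map !size_neighbours.
have surjh z : exists x, h x = z.
  case: (tree_inhabited T) => r.
  have [m] := ubnP (dist z (h r)); elim: m z => // m IH z zm.
  have [->|zr] := eqVneq z (h r); first by exists r.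
  have [u zu du] := dist_next zr.
  have [|x hx] := IH u; first by lia.
  have [|y _ <-] := hnext x z; last by exists y.
  by rewrite hx adj_sym.
pose k z := projT1 (cid (surjh z)).
have kK : cancel k h by move=> z; rewrite /k; case: cid.
have hK : cancel h k by move=> x; apply: injh; rewrite kK.
have hadjE x y : adj (h x) (h y) = adj x y by rewrite !adj_dist hdist.
by exists (Aut (Bijective hK kK) hadjE).
Qed.

(** A bijection from the neighbours of [x] onto those of [x'] mapping [p] to [p']. *)
Definition star_map x p x' p' y : T :=
  nth x' (p' :: rem p' (neighbours x')) (index y (p :: rem p (neighbours x))).

Lemma star_mapl x p x' p' : star_map x p x' p' p = p'.
Proof. by rewrite /star_map /= eqxx. Qed.

Lemma size_star x p : adj x p -> size (p :: rem p (neighbours x)) = n.+1.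
Proof. by move=> xp; rewrite /= size_rem ?mem_neighbours// size_neighbours. Qed.

Lemma mem_star x p y : adj x p -> (y \in p :: rem p (neighbours x)) = adj x y.
Proof.
move=> xp; rewrite -mem_neighbours; apply/esym/perm_mem/perm_to_rem.
by rewrite mem_neighbours.
Qed.

Lemma star_map_adj x p x' p' y : adj x p -> adj x' p' -> adj x y ->
  adj x' (star_map x p x' p' y).
Proof.
move=> xp xp' xy; rewrite -(mem_star _ xp') mem_nth// size_star//.
by rewrite -[leqRHS](size_star xp) index_mem mem_star.
Qed.

Lemma star_map_inj x p x' p' y z : adj x p -> adj x' p' -> adj x y -> adj x z ->
  star_map x p x' p' y = star_map x p x' p' z -> y = z.
Proof.
move=> xp xp' xy xz.
have lt_index u : adj x u ->
    index u (p :: rem p (neighbours x)) < size (p' :: rem p' (neighbours x')).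
  by move=> xu; rewrite size_star// -(size_star xp) index_mem mem_star.
have u' : uniq (p' :: rem p' (neighbours x')).
  by rewrite -(perm_uniq (perm_to_rem _)) ?neighbours_uniq// mem_neighbours.
move=> /eqP; rewrite /star_map nth_uniq ?lt_index// => /eqP E.
rewrite -[y](@nth_index _ x y (p :: rem p (neighbours x))) ?mem_star// E.
by rewrite nth_index ?mem_star.
Qed.

(** The state [((x, p), (x', p'))] records the current vertex [x] of a path, the
    vertex [p] before it, and their images. *)
Definition transport_step (e : (T * T) * (T * T)) y :=
  ((y, e.1.1), (star_map e.1.1 e.1.2 e.2.1 e.2.2 y, e.2.1)).

(** The image of [z] is found by transport along the geodesic from [x], matching each star with its
    image by [star_map]. Around every [z] the resulting map is a single [star_map], the previous
    vertex included, which gives the local conditions of [local_bij_aut]. *)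
Lemma aut_transitive x y : exists h : aut T, h x = y.
Proof.
have nb z : exists p, adj z p.
  by have [p zp _] := @neighbour_avoid n T z [::] (leq0n _); exists p.
(* No vertex comes before [x] or [y] on the paths; arbitrary neighbours take that place. *)
have [p0 xp0] := nb x; have [q0 yq0] := nb y.
pose st (s : seq T) := foldl transport_step ((x, p0), (y, q0)) s.
have stP (s : seq T) : path (@adj n T) x s ->
    [/\ (st s).1.1 = last x s, adj (st s).1.1 (st s).1.2
      & adj (st s).2.1 (st s).2.2].
  elim/last_ind: s => [|s z IH] //; rewrite rcons_path => /andP[/IH[lp ap aq] pz].
  rewrite /st foldl_rcons -/(st s) /= last_rcons; rewrite lp in ap *; split => //.
    by rewrite adj_sym.
  by rewrite adj_sym star_map_adj.
pose h z := (st (geodesic x z)).2.1.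
have hE z : exists p' q', [/\ adj z p', adj (h z) q' &
    forall t, adj z t -> h t = star_map z p' (h z) q' t].
  have [xz _ lz] := geodesicP x z; have [e11 ap aq] := stP _ xz.
  exists (st (geodesic x z)).1.2, (st (geodesic x z)).2.2.
  rewrite e11 lz in ap; split => // t zt.
  have [E|E] := geodesic_rcons x zt.
    by rewrite /h E /st foldl_rcons -/(st _) /= e11 lz.
  rewrite {2}E /h E /st foldl_rcons -/(st _) /=.
  have [xt _ lt] := geodesicP x t; have [-> _ _] := stP _ xt.
  by rewrite lt star_mapl.
have [||k kh] := local_bij_aut (h := h).
- move=> z t zt; have [p' [q' [zp hq hz]]] := hE z; rewrite (hz t zt).
  exact: star_map_adj.
- move=> z t t' zt zt'; have [p' [q' [zp hq hz]]] := hE z.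
  by rewrite (hz t zt) (hz t' zt'); exact: star_map_inj.
by exists k; rewrite kh /h (@geodesicE n T x [::]).
Qed.

End Transitivity.

(** * Spheromorphisms and clopen sets *)

Section Clopen.
Variables (n : nat) (T : regTree n).
Implicit Types (a b c d u v : T) (x : boundary T) (w : way T) (g : hier T) (h : aut T).
Implicit Types (A : set (boundary T)) (s t : seq (T * T)).
Local Open Scope nat_scope.

Lemma hierK g : cancel g (g^-1)%g.
Proof. by move=> x; rewrite -[LHS]/((g^-1 * g)%g x) mulVg /= aut_map_id. Qed.

Lemma hierVK g : cancel (g^-1)%g g.
Proof. by move=> x; rewrite -[LHS]/((g * g^-1)%g x) mulgV /= aut_map_id. Qed.

Lemma hier_imageE g A : g @` A = (g^-1)%g @^-1` A.
Proof.
apply/seteqP; split => [_ [x Ax <-]|x Ax] /=; first by rewrite hierK.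
by exists ((g^-1)%g x) => //; rewrite hierVK.
Qed.

Lemma hier_image1 A : (1%g : hier T) @` A = A.
Proof.
apply/seteqP; split => [_ [x Ax <-]|x Ax] /=; first by rewrite aut_map_id.
by exists x => //=; rewrite aut_map_id.
Qed.

Lemma hier_imageM g g' A : (g * g')%g @` A = g @` (g' @` A).
Proof. by rewrite -image_comp. Qed.

Lemma hier_imageK g : cancel (fun A => g @` A) (fun A => (g^-1)%g @` A).
Proof. by move=> A /=; rewrite -hier_imageM mulVg hier_image1. Qed.

Lemma hier_of_autM h h' :
  (hier_of_aut h * hier_of_aut h')%g = hier_of_aut (aut_comp h h').
Proof. by apply: hier_eq => x; rewrite /= aut_map_comp. Qed.

Lemma hier_of_autV h : ((hier_of_aut h)^-1)%g = hier_of_aut (aut_inv h).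
Proof.
by apply: hier_eq => x; apply: (can_inj (hierK (hier_of_aut h)));
  rewrite hierVK /= aut_mapVK.
Qed.

Lemma aut_image_ball h a b :
  hier_of_aut h @` tree_ball a b = tree_ball (h a) (h b).
Proof.
rewrite hier_imageE hier_of_autV; apply/seteqP; split => x /=.
  by move/(ball_aut h); rewrite aut_mapVK.
move/(ball_aut (aut_inv h)); rewrite /aut_inv.
by case: cid => k /= [hk _]; rewrite !hk.
Qed.

(** The balls cut off by the successive edges of a way form a neighbourhood base at its end: once
    the way has settled with respect to [c] and [d], they are contained in [tree_ball c d] if the
    end is. *)
Lemma nbhs_way_end w U : nbhs (way_end w) U ->
  exists i, tree_ball (w i) (w i.+1) `<=` U.
Proof.
rewrite nbhsE => -[O [[BB sB <-] [C BC Cx]] sOU].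
have [D sD CE] := sB _ BC.
have {}Cx E : E \in D -> tree_balls E /\ E (way_end w).
  move=> ED; split; first by have := sD _ ED; rewrite inE.
  by move: Cx; rewrite -CE; exact.
suff H (l : seq (set (boundary T))) :
    (forall E, E \in l -> tree_balls E /\ E (way_end w)) ->
    exists i, forall j E, (i <= j)%N -> E \in l -> tree_ball (w j) (w j.+1) `<=` E.
  have [i Hi] := H (enum_fset D) Cx.
  exists i => x xi; suff Cx' : C x by apply: sOU; exists C.
  by rewrite -CE => E /= ED; exact: (Hi i E _ ED).
elim: l {Cx} => [|E l IH] Cx; first by exists 0.
have [|i Hi] := IH; first by move=> E' E'D; apply: Cx; rewrite inE E'D orbT.
have [|[c [d [cd EE]]] Ew] := Cx E; first by rewrite inE eqxx.
have [k wk] := settled_seq w [:: c; d].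
have wc : settled w c k by apply: wk; rewrite inE eqxx.
have wd : settled w d k by apply: wk; rewrite !inE eqxx orbT.
rewrite EE (mem_ball cd wc wd) in Ew.
exists (maxn i k) => j E'; rewrite geq_max => /andP[ij kj].
rewrite inE => /orP[/eqP ->|]; last exact: Hi.
rewrite EE -(subnKC kj) -addnS; apply: ball_sub => //; rewrite ?wc ?wd; try lia.
by rewrite addnS way_adj.
Qed.

(** König's lemma: a branch on which the induction fails would end at a boundary
    point without a good neighbourhood. *)
Lemma ball_ind (P : T -> T -> Prop) :
  (forall a b, adj a b -> (forall c, adj b c -> c != a -> P b c) -> P a b) ->
  (forall x : boundary T, exists2 U, nbhs x U &
     forall a b, adj a b -> tree_ball a b `<=` U -> P a b) ->
  forall a b, adj a b -> P a b.
Proof.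
move=> Pind Ploc a b ab; apply: contrapT => nPab.
have [|w [_ _ wP]] := @way_choose n T (fun u v => ~ P u v) a b _ ab nPab.
  move=> x y xy nPxy; apply: contrapT => nex; apply: nPxy; apply: Pind => // z yz zx.
  by apply: contrapT => nPyz; apply: nex; exists z.
have [U Uw UP] := Ploc (way_end w).
have [i wi] := nbhs_way_end Uw.
by case: (wP i); apply: UP => //; exact: way_adj.
Qed.

Lemma ball_cover a b (x : boundary T) : adj a b -> tree_ball a b x \/ tree_ball b a x.
Proof. by move=> ab; rewrite (ballC ab); exact: EM. Qed.

Definition ball_union s : set (boundary T) :=
  [set x | exists2 e, e \in s & tree_ball e.1 e.2 x].

Definition aut_on g A := exists h, forall x, A x -> g x = aut_map h x.

Lemma local_aut_nbhs g (x : boundary T) : exists2 U, nbhs x U &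
  forall a b, adj a b -> tree_ball a b `<=` U -> aut_on g (tree_ball a b).
Proof.
have [_ _ /(_ x)[h hx]] := hierP g.
by exists [set y | g y = aut_map h y] => // a b _ ab; exists h.
Qed.

Lemma aut_cover_ball g a b : adj a b -> exists s,
  [/\ forall e, e \in s -> adj e.1 e.2,
      forall e, e \in s -> aut_on g (tree_ball e.1 e.2)
    & tree_ball a b `<=` ball_union s].
Proof.
move: a b; apply: ball_ind => [a b ab IH|x].
  have : forall c, exists s, adj b c -> c != a ->
    [/\ forall e, e \in s -> adj e.1 e.2,
      forall e, e \in s -> aut_on g (tree_ball e.1 e.2)
    & tree_ball b c `<=` ball_union s].
    move=> c; have [[bc ca]|nc] := pselect (adj b c /\ c != a).
      by have [s] := IH c bc ca; exists s.
    by exists [::] => bc ca; case: nc.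
  move=> /choice[f fP].
  exists (flatten [seq f c | c <- neighbours b & c != a]); split.
  - move=> e /flatten_mapP[c]; rewrite mem_filter mem_neighbours => /andP[ca bc].
    by have [+ _ _] := fP c bc ca; apply.
  - move=> e /flatten_mapP[c]; rewrite mem_filter mem_neighbours => /andP[ca bc].
    by have [_ + _] := fP c bc ca; apply.
  - move=> x /(ball_children _ ab)[c [bc ca]].
    have [_ _ fc] := fP c bc ca; move/fc => [e ef xe]; exists e => //.
    by apply/flatten_mapP; exists c => //; rewrite mem_filter mem_neighbours ca.
have [U xU UP] := local_aut_nbhs g x.
exists U => // a b ab abU; exists [:: (a, b)]; split => [e|e|y aby].
- by rewrite inE => /eqP ->.
- by rewrite inE => /eqP ->; exact: UP.
- by exists (a, b); rewrite ?inE.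
Qed.

Lemma edge_ex : exists a b : T, adj a b.
Proof.
case: (tree_inhabited T) => a.
by have [b ab _] := @neighbour_avoid n T a [::] (leq0n _); exists a, b.
Qed.

Lemma aut_cover g : exists s,
  [/\ forall e, e \in s -> adj e.1 e.2,
      forall e, e \in s -> aut_on g (tree_ball e.1 e.2)
    & forall x, ball_union s x].
Proof.
have [a [b ab]] := edge_ex; have ba : adj b a by rewrite adj_sym.
have [s [s1 s2 s3]] := aut_cover_ball g ab.
have [t [t1 t2 t3]] := aut_cover_ball g ba.
exists (s ++ t); split => [e|e|x].
- by rewrite mem_cat => /orP[/s1|/t1].
- by rewrite mem_cat => /orP[/s2|/t2].
- by have [/s3|/t3] := ball_cover x ab => -[e es xe]; exists e;
    rewrite // mem_cat es ?orbT.
Qed.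

(** Disjoint unions of [m] balls, built one ball at a time so that counts add under disjoint union;
    [ball_sumP] recovers the indexed form used in [clop_class]. *)
Fixpoint ball_sum m A : Prop :=
  if m is m'.+1 then exists B A',
    [/\ tree_balls B, ball_sum m' A', B `&` A' = set0 & A = B `|` A']
  else A = set0.

Lemma ball_sumD m m' A A' : ball_sum m A -> ball_sum m' A' -> A `&` A' = set0 ->
  ball_sum (m + m') (A `|` A').
Proof.
elim: m A => [|m IH] A /=; first by move=> -> ? _; rewrite set0U.
move=> [B [C [Bb Cm BC ->]]] A'm; rewrite setIUl setU_eq0 => -[BA' CA'].
exists B, (C `|` A'); split => //; first exact: IH.
- by rewrite setIUr BC BA' setU0.
- by rewrite setUA.
Qed.

Lemma ball_sumP m A : ball_sum m A <-> exists B : 'I_m -> set (boundary T),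
  [/\ forall i, tree_balls (B i), trivIset setT B & A = \bigcup_i B i].
Proof.
split.
  elim: m A => [|m IH] A /=.
    move=> ->; exists (fun=> set0); split => //; [by case|by move=> []|].
    by rewrite bigcup0.
  move=> [B [_ [Bb /IH[C [Cb Cd ->]] BC ->]]].
  exists (fun i => if unlift ord0 i is Some j then C j else B); split.
  - by move=> i; case: unliftP => [j|] _.
  - move=> i j _ _; case: unliftP => [i'|] ->; case: unliftP => [j'|] ->.
    + by move=> /(Cd _ _ I I) ->.
    + by move=> [x [Cx Bx]]; suff : set0 x by []; rewrite -BC; split=> //; exists i'.
    + by move=> [x [Bx Cx]]; suff : set0 x by []; rewrite -BC; split=> //; exists j'.
    + by [].
  - apply/seteqP; split => [x [Bx|[j _ Cx]]|x [i _]].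
    + by exists ord0 => //; rewrite unlift_none.
    + by exists (lift ord0 j) => //; rewrite liftK.
    + by case: unliftP => [j|] _ Bx; [right; exists j|left].
elim: m A => [|m IH] A [B [Bb Bd ->]] /=.
  by rewrite bigcup0// => -[].
exists (B ord0), (\bigcup_j B (lift ord0 j)); split => //.
- apply: IH; exists (B \o lift ord0); split => // [i|i j _ _ /(Bd _ _ I I)].
    exact: Bb.
  exact: lift_inj.
- apply/seteqP; split => // x [B0 [j _ Bj]].
  by have /eqP := Bd ord0 (lift ord0 j) I I (ex_intro _ x (conj B0 Bj)).
- apply/seteqP; split => [x [i _]|x [Bx|[j _ Bx]]]; last 2 first.
  + by exists ord0.
  + by exists (lift ord0 j).
  by case: (unliftP ord0 i) => [j|] -> Bx; [right; exists j|left].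
Qed.

Lemma aut_on_image g h A : (forall x, A x -> g x = aut_map h x) ->
  g @` A = hier_of_aut h @` A.
Proof.
move=> gh; apply/seteqP; split => _ [x Ax <-]; exists x => //=;
  by rewrite gh.
Qed.

Hypothesis n_gt0 : 0 < n.

(** On small balls [g] is an automorphism and the image is one ball. A larger ball has [n] children,
    each contributing a number congruent to 1, and [n] is congruent to 1 modulo [n - 1]. *)
Lemma hier_image_ball g a b : adj a b ->
  exists2 m, m = 1 %[mod n.-1] & ball_sum m (g @` tree_ball a b).
Proof.
move: a b; apply: ball_ind => [a b ab IH|x]; last first.
  have [U xU UP] := local_aut_nbhs g x; exists U => // a b ab abU.
  have [h gh] := UP a b ab abU; exists 1 => //; rewrite (aut_on_image gh) aut_image_ball.
  exists (tree_ball (h a) (h b)), set0; split; rewrite ?setI0 ?setU0//.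
  by exists (h a), (h b); rewrite aut_adj.
have children (s : seq T) : uniq s -> {subset s <= rem a (neighbours b)} ->
    exists2 m, m = size s %[mod n.-1] &
      ball_sum m (g @` [set x | exists2 c, c \in s & tree_ball b c x]).
  have sub c : c \in rem a (neighbours b) -> adj b c /\ c != a.
    by rewrite mem_rem_uniq ?neighbours_uniq// !inE mem_neighbours => /andP[-> ->].
  elim: s => [|c s IHs] /=.
    move=> _ _; exists 0 => //; apply/seteqP; split => // y [x [c]].
    by rewrite in_nil.
  move=> /andP[cs us] scs; have [bc ca] := sub c (scs c (mem_head _ _)).
  have [m1 m1E m1s] := IH c bc ca.
  have ss : {subset s <= rem a (neighbours b)}.
    by move=> d ds; apply: scs; rewrite inE ds orbT.
  have [m2 m2E m2s] := IHs us ss.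
  exists (m1 + m2); first by rewrite -modnDm m1E m2E modnDm add1n.
  rewrite [X in ball_sum _ X](_ : _ = g @` tree_ball b c `|`
    g @` [set x | exists2 c, c \in s & tree_ball b c x]).
    apply: ball_sumD => //; apply/seteqP; split => // _ [[x xc <-] [y [d ds yd]]].
    move=> /(can_inj (hierK g)) yx; rewrite yx in yd.
    have [bd _] := sub d (ss d ds).
    by rewrite (children_disjoint bc bd xc yd) ds in cs.
  apply/seteqP; split => [_ [x [d + xd] <-]|_ [[x xc <-]|[x [d ds xd] <-]]].
  - rewrite inE => /orP[/eqP dc|ds]; first by left; exists x; rewrite // -dc.
    by right; exists x => //; exists d.
  - by exists x => //; exists c; rewrite ?mem_head.
  - by exists x => //; exists d; rewrite // inE ds orbT.
have [m mE] := children _ (rem_uniq a (neighbours_uniq b)) (fun _ => id).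
have sz : size (rem a (neighbours b)) = n.
  by rewrite size_rem ?size_neighbours// mem_neighbours adj_sym.
rewrite [X in g @` X](_ : _ = tree_ball a b) => [ms|].
  by exists m => //; rewrite mE sz -{1}(prednK n_gt0) -addn1 modnDl.
apply/seteqP; split => x.
  move=> [c]; rewrite mem_rem_uniq ?neighbours_uniq// !inE mem_neighbours.
  by move=> /andP[ca bc] xc; apply/ball_children => //; exists c.
move=> /(ball_children _ ab)[c [bc ca] xc]; exists c => //.
by rewrite mem_rem_uniq ?neighbours_uniq// !inE mem_neighbours ca.
Qed.

Lemma ball_sum_image g m A : ball_sum m A ->
  exists2 m', m' = m %[mod n.-1] & ball_sum m' (g @` A).
Proof.
elim: m A => [|m IH] A /=.
  by move=> ->; exists 0; rewrite // image_set0.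
move=> [_ [A' [[a [b [ab ->]]] /IH[m2 m2E m2s] d ->]]].
have [m1 m1E m1s] := hier_image_ball g ab.
exists (m1 + m2); first by rewrite -modnDm m1E m2E modnDm add1n.
rewrite image_setU; apply: ball_sumD => //.
apply/seteqP; split => // _ [[x xB <-] [y yA]] /(can_inj (hierK g)) yx.
by suff : set0 x by []; rewrite -d; split; rewrite // -yx.
Qed.

Lemma hier_clop_class iota g A : clop_class iota A -> clop_class iota (g @` A).
Proof.
move=> [[[oA cA] A0 AT] [m [B [Bb Bd AE mi]]]].
have : ball_sum m A by apply/ball_sumP; exists B.
move=> /(ball_sum_image g)[m' m'm /ball_sumP[B' [B'b B'd B'E]]]; split; last first.
  by exists m', B'; split => //; rewrite m'm.
have gc : continuous (g^-1)%g by case: (hierP (g^-1)%g).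
split.
- by rewrite hier_imageE; split; [apply: open_comp|apply: closed_comp] => // x _; exact: gc.
- by case: A0 => x Ax; exists (g x); exists x.
- move=> gA; apply: AT; apply/seteqP; split => // x _.
  have : [set: boundary T] (g x) by [].
  by rewrite -gA => -[y Ay /(can_inj (hierK g)) <-].
Qed.

Lemma clop_class_union iota A : clop_class iota A ->
  exists2 s, (forall e, e \in s -> adj e.1 e.2) & A = ball_union s.
Proof.
move=> [_ [m [B [Bb _ -> _]]]].
have : forall i, exists e : T * T, adj e.1 e.2 /\ B i = tree_ball e.1 e.2.
  by move=> i; have [a [b [ab ->]]] := Bb i; exists (a, b).
move=> /choice[f fP]; exists (map f (enum 'I_m)).
  by move=> e /mapP[i _ ->]; case: (fP i).
apply/seteqP; split => [x [i _]|x [_ /mapP[i _ ->]]].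
  by case: (fP i) => _ -> xi; exists (f i) => //; rewrite map_f// mem_enum.
by case: (fP i) => _ <-; exists i.
Qed.

Definition aut_edge h (e : T * T) : T * T := (h e.1, h e.2).

Lemma aut_image_union h s :
  hier_of_aut h @` ball_union s = ball_union (map (aut_edge h) s).
Proof.
apply/seteqP; split => [_ [x [e es xe] <-]|x [_ /mapP[e es ->]]] /=.
  exists (aut_edge h e); first exact: map_f.
  by rewrite /= -aut_image_ball; exists x.
by rewrite -aut_image_ball => -[y ye <-]; exists y => //; exists e.
Qed.

End Clopen.

(** * Translates of clopen sets by automorphisms moving far *)

Lemma finite_lists (X : choiceType) (F : seq X) k :
  finite_set [set s : seq X | size s = k /\ {subset s <= F}].
Proof.
elim: k => [|k IH].
  by apply: sub_finite_set (finite_set1 [::]) => s [/size0nil].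
have := finite_image2 cons (finite_seq F) IH.
apply: sub_finite_set => -[|x s] [//= [sk] sF]; exists x => /=.
  by apply: sF; rewrite mem_head.
by exists s => //; split=> // y ys; apply: sF; rewrite inE ys orbT.
Qed.

Section FarMoves.
Variables (n : nat) (T : regTree n).
Implicit Types (a b c d u v : T) (x : boundary T) (w : way T) (g : hier T).
Implicit Types (h : aut T) (A : set (boundary T)) (s t : seq (T * T)).
Local Open Scope nat_scope.

Definition edge_vertices s : seq T := map fst s ++ map snd s.

Lemma edge_vertices1 s e : e \in s -> e.1 \in edge_vertices s.
Proof. by move=> es; rewrite mem_cat map_f. Qed.

Lemma edge_vertices2 s e : e \in s -> e.2 \in edge_vertices s.
Proof. by move=> es; rewrite mem_cat map_f// orbT. Qed.

Lemma edge_vertices_aut h s : edge_vertices (map (aut_edge h) s) = map h (edge_vertices s).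
Proof. by rewrite /edge_vertices map_cat -!map_comp. Qed.

Lemma dist_bound r (F : seq T) : exists L, {in F, forall v, dist r v <= L}.
Proof.
elim: F => [|v F [L IH]]; first by exists 0.
exists (dist r v + L) => u; rewrite inE => /orP[/eqP ->|/IH]; lia.
Qed.

(** An edge lying in the branch [branch a b] cuts off, on one of its sides, a
    ball contained in [tree_ball a b]. *)
Lemma ball_union_side a b s : adj a b -> (forall e, e \in s -> adj e.1 e.2) ->
  {in edge_vertices s, forall v, dist b v < dist a v} ->
  ball_union s `<=` tree_ball a b \/ ~` ball_union s `<=` tree_ball a b.
Proof.
move=> ab sadj sab.
have [[e es e21]|nex] := pselect (exists2 e, e \in s & dist a e.2 < dist a e.1).
  right; have e_adj : adj e.2 e.1 by rewrite adj_sym sadj.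
  have sub : tree_ball e.2 e.1 `<=` tree_ball a b.
    by apply: ball_sub => //; apply: sab; rewrite ?edge_vertices1 ?edge_vertices2.
  by apply: subset_trans sub; rewrite (ballC (sadj _ es)) => x nx xe; apply: nx; exists e.
left => x [e es]; have e_adj := sadj _ es; apply: ball_sub => //.
- by apply: sab; exact: edge_vertices1.
- by apply: sab; exact: edge_vertices2.
- rewrite ltnNge; apply/negP => e21; apply: nex; exists e => //.
  by have := dist_step a e_adj; rewrite !(dist_sym _ a); lia.
Qed.

Hypothesis n_gt1 : 1 < n.

Let n_gt0 : 0 < n. Proof. exact: ltnW. Qed.

(** No edge of [s] lies beyond [{a, b}], so the union cannot separate the points of [tree_ball a b]:
    it contains all of them or none. *)
Lemma ball_union_near a b s : adj a b -> (forall e, e \in s -> adj e.1 e.2) ->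
  {in edge_vertices s, forall v, dist a v < dist b v} ->
  tree_ball a b `<=` ball_union s \/ ball_union s `<=` tree_ball b a.
Proof.
move=> ab sadj sab; have ba : adj b a by rewrite adj_sym.
have [|sub] := ball_union_side ba sadj sab; first by right.
by left => x xab; apply: contrapT => /sub; rewrite (ballC ab).
Qed.

(** By [ball_union_near], [A] contains or avoids [tree_ball u v], and likewise [tree_ball t v]. The
    point [x0] behind a third neighbour of [v], which exists as [n > 1], lies in both balls, so the
    two answers agree; and the two balls cover the boundary. *)
Lemma ball_union_two_sided u v (t : T) s s' A : adj u v -> adj v t -> u != t ->
  (forall e, e \in s -> adj e.1 e.2) -> (forall e, e \in s' -> adj e.1 e.2) ->
  {in edge_vertices s, forall z, dist u z < dist v z} ->
  {in edge_vertices s', forall z, dist t z < dist v z} ->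
  A = ball_union s -> A = ball_union s' -> A = set0 \/ A = setT.
Proof.
move=> uv vt ut sadj s'adj su s't As As'.
have vu : adj v u by rewrite adj_sym.
have tv : adj t v by rewrite adj_sym.
have vu_tv : tree_ball v u `<=` tree_ball t v.
  by move=> x xu; apply/(ball_children _ tv); exists u.
have vt_uv : tree_ball v t `<=` tree_ball u v.
  by move=> x xu; apply/(ball_children _ uv); exists t => //; rewrite eq_sym.
have [z vz] := @neighbour_avoid n T v [:: u; t] n_gt1.
rewrite !inE negb_or => /andP[zu zt].
have [x0 x0z] := ball_neq0 n_gt0 vz.
have x0u : ~ tree_ball v u x0.
  by move=> /(children_disjoint vz vu x0z) zuE; rewrite zuE eqxx in zu.
have x0t : ~ tree_ball v t x0.
  by move=> /(children_disjoint vz vt x0z) ztE; rewrite ztE eqxx in zt.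
have := ball_union_near uv sadj su; rewrite -As.
have := ball_union_near tv s'adj s't; rewrite -As'.
move=> [tvA|Avt] [uvA|Avu].
- right; apply/seteqP; split => // x _.
  by have [/uvA//|/vu_tv/tvA] := ball_cover x uv.
- by exfalso; apply: x0u; apply: Avu; apply: tvA; rewrite (ballC vt).
- by exfalso; apply: x0t; apply: Avt; apply: uvA; rewrite (ballC vu).
- left; apply/seteqP; split => // x Ax.
  have := children_disjoint vu vt (Avu _ Ax) (Avt _ Ax).
  by move=> utE; rewrite utE eqxx in ut.
Qed.

Lemma clop_class_edges iota (L : seq (set (boundary T))) :
  (forall A, A \in L -> clop_class iota A) -> exists F : seq T,
  forall A, A \in L -> exists s, [/\ forall e, e \in s -> adj e.1 e.2,
    {subset edge_vertices s <= F} & A = ball_union s].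
Proof.
elim: L => [|A L IH] clopL; first by exists [::].
have [|F FP] := IH; first by move=> B BL; apply: clopL; rewrite inE BL orbT.
have [s sadj As] := clop_class_union (clopL A (mem_head _ _)).
exists (edge_vertices s ++ F) => B; rewrite inE => /orP[/eqP ->|BL].
  by exists s; split => // v vs; rewrite mem_cat vs.
have [s' [s'adj s'F Bs']] := FP B BL; exists s'; split => // v /s'F vF.
by rewrite mem_cat vF orbT.
Qed.

(** The automorphism carries a base vertex far along a way. A set common to both families would be
    described by edges near either end, hence be trivial. *)
Lemma clop_class_move iota (L L' : seq (set (boundary T))) :
  (forall A, A \in L -> clop_class iota A) ->
  (forall A, A \in L' -> clop_class iota A) ->
  exists h, forall A, A \in L -> hier_of_aut h @` A \notin L'.
Proof.
move=> clopL clopL'.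
have [F FP] := clop_class_edges clopL; have [F' FP'] := clop_class_edges clopL'.
have [a [b ab]] := edge_ex T; have [w [w0 w1]] := way_ex n_gt0 ab.
have [R RP] := dist_bound (w 0) (F ++ F').
have wd i k : dist (w i) (w (i + k)) = k.
  have := @settled_step n T w (w i) i; rewrite distxx dist_adj ?way_adj//.
  by move=> /(_ isT k) ->; rewrite distxx.
(* [R.*2.+2] allows [R] steps, two separating edges and [R] more steps: vertices within [R] of [w 0]
   stay on the side of [w R], those within [R] of its image on the side of [w R.+2]. *)
have [h h0] := aut_transitive (w 0) (w (R.*2.+2)).
exists h => A AL; apply/negP => A'L'.
have [s [sadj sF AE]] := FP A AL; have [s' [s'adj s'F AE']] := FP' _ A'L'.
have [_ A0 AT] : clop (hier_of_aut h @` A) by case: (clopL' _ A'L').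
have [|||||||A0'|//] := @ball_union_two_sided (w R) (w R.+1) (w R.+2) s'
    (map (aut_edge h) s) (hier_of_aut h @` A) (way_adj _ _) (way_adj _ _).
- exact: way_nonbacktracking.
- by [].
- by move=> _ /mapP[e es ->]; rewrite /= aut_adj sadj.
- move=> z zs'; rewrite dist_ltnN ?(adj_sym _ (w R)) ?way_adj//; apply/negP => zR.
  have wR : dist (w R) (w 0) < dist (w R.+1) (w 0).
    by rewrite !(dist_sym _ (w 0)) (wd 0) (wd 0).
  have := dist_across (way_adj w R) wR zR; rewrite (wd 0).
  have := RP z; rewrite mem_cat s'F// orbT => /(_ isT); lia.
- move=> y; rewrite edge_vertices_aut => /mapP[z zs ->].
  rewrite dist_ltnN ?way_adj//; apply/negP => zR.
  have wR : dist (w R.+2) (h (w 0)) < dist (w R.+1) (h (w 0)).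
    rewrite h0 (_ : R.*2.+2 = R.+2 + R) ?wd; last by lia.
    by rewrite (_ : R.+2 + R = R.+1 + R.+1) ?wd; last by lia.
  have := dist_across (way_adj w R.+1) zR wR.
  rewrite {2}h0 (_ : R.*2.+2 = R.+2 + R) ?wd; last by lia.
  rewrite aut_dist dist_sym.
  by have := RP z; rewrite mem_cat sF// => /(_ isT); lia.
- exact: AE'.
- by rewrite {1}AE aut_image_union.
- by rewrite A0' in A0; case: A0.
Qed.

(** Prolonging the geodesic from [r] to [h r] gives a way whose end lies in some ball of the
    covering [s]; when [h r] is far away, it already lies in the corresponding branch, with a
    neighbourhood around it. *)
Lemma far_ball r s t :
  (forall e, e \in s -> adj e.1 e.2) -> (forall x, ball_union s x) ->
  (forall e, e \in t -> adj e.1 e.2) ->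
  exists F : seq T, forall h, h r \notin F ->
    exists2 e, e \in s & {in edge_vertices t, forall v, dist e.2 (h v) < dist e.1 (h v)}.
Proof.
move=> sadj sT tadj.
have [L LP] := dist_bound r (edge_vertices t).
have [R RP] := dist_bound r (edge_vertices s).
(* [R] places [h r] beyond the vertices of [s]; the further [L] leaves room for the vertices [h v],
   which are within [L] of [h r]. *)
have [F FP] := finite_dist_ball r (R + L); exists F => h hrF.
have rhr : R + L < dist r (h r).
  by rewrite ltnNge; apply: contra hrF; exact: FP.
have hrNr : h r != r by rewrite eq_sym -dist_eq0; lia.
have [u hu du] := dist_next hrNr; have uh : adj u (h r) by rewrite adj_sym.
have [w [w0 w1]] := way_ex n_gt0 uh.
have ws v : v \in edge_vertices s -> settled w v 1.
  move=> vs; apply: (@settled_add _ _ _ _ 0); apply: settled_step; rewrite w0 w1.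
  rewrite !(dist_sym v) ltnNge; apply/negP => hv.
  have {}hv : dist (h r) v < dist u v by have := dist_step v uh; lia.
  have ur : dist u r < dist (h r) r by lia.
  have := dist_across uh ur hv; rewrite (dist_sym r u).
  have := RP v vs; rewrite (dist_sym (h r)) in du rhr *; lia.
have [e es] := sT (way_end w); exists e => // v vt.
have e1 := edge_vertices1 es; have e2 := edge_vertices2 es.
have ehr : dist e.2 (h r) < dist e.1 (h r).
  by rewrite -w1; apply/mem_ball; rewrite ?sadj//; exact: ws.
apply: (branch_near _ ehr); first exact: sadj.
rewrite aut_dist; have := LP v vt; have := RP _ e2.
have := dist_triangle e.2 r (h r); lia.
Qed.

Lemma aut_orbit_moved_finite g t : (forall e, e \in t -> adj e.1 e.2) ->
  finite_set [set A | exists2 h, A = hier_of_aut h @` ball_union t &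
    forall k, g @` A <> hier_of_aut k @` A].
Proof.
move=> tadj; have [s [sadj saut sT]] := aut_cover g.
have [r _] := edge_ex T.
have [F FP] := far_ball r sadj sT tadj.
have [L LP] := dist_bound r (edge_vertices t).
(* If [h r] lies in [F], the edges of the translate join vertices of [G], and there are finitely
   many lists of such pairs with the length of [t]. *)
have [G GP] : exists G : seq T, forall f v, f \in F -> dist f v <= L -> v \in G.
  elim: F {FP} => [|f F [G GP]]; first by exists [::].
  have [G' GP'] := finite_dist_ball f L; exists (G' ++ G) => f' v.
  rewrite inE mem_cat => /orP[/eqP ->|f'F] fv; first by rewrite GP'.
  by rewrite (GP f')// orbT.
have := finite_image (@ball_union n T) (finite_lists (allpairs pair G G) (size t)).
apply: sub_finite_set => _ [h -> gk].
have [hF|/FP[e es he]] := boolP (h r \in F).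
  exists (map (aut_edge h) t); last by rewrite aut_image_union.
  split; first by rewrite size_map.
  move=> _ /mapP[e et ->]; apply/allpairsP; exists (h e.1, h e.2); split => //=.
    by apply: (GP (h r)) => //; rewrite aut_dist LP ?edge_vertices1.
  by apply: (GP (h r)) => //; rewrite aut_dist LP ?edge_vertices2.
exfalso; have [k kg] := saut e es; apply: (gk k); rewrite aut_image_union.
have [|||sub|sub] := @ball_union_side e.1 e.2 (map (aut_edge h) t).
- exact: sadj.
- by move=> _ /mapP[e' e't ->]; rewrite /= aut_adj tadj.
- by move=> y; rewrite edge_vertices_aut => /mapP[v vt ->]; exact: he.
- by apply: aut_on_image => x /sub; exact: kg.
set A := ball_union _ in sub *.
have E : g @` (~` A) = hier_of_aut k @` (~` A).
  by apply: aut_on_image => x /sub; exact: kg.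
have C (f : hier T) : f @` A = ~` (f @` (~` A)).
  by rewrite !hier_imageE preimage_setC setCK.
by rewrite C E -C.
Qed.

End FarMoves.

(** * Hilbert spaces *)

Section LinearSpan.
Variables (K : nzRingType) (E : lmodType K).
Implicit Types (A : set E) (x y : E).

Lemma lin_span_gen A : A `<=` lin_span A.
Proof.
move=> x Ax; exists 1%N, (fun=> 1), (fun=> x); split => //.
by rewrite big_ord1 scale1r.
Qed.

Lemma lin_span0 A : lin_span A 0.
Proof. by exists 0%N, (fun=> 0), (fun=> 0); split => [[]//|]; rewrite big_ord0. Qed.

Lemma lin_spanD A a x y : lin_span A x -> lin_span A y -> lin_span A (a *: x + y).
Proof.
move=> [m [c [u [Au ->]]]] [m' [c' [u' [Au' ->]]]].
exists (m + m')%N.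
exists (fun i => match fintype.split i with inl j => a * c j | inr j => c' j end).
exists (fun i => match fintype.split i with inl j => u j | inr j => u' j end).
split; first by move=> i; case: fintype.split.
rewrite big_split_ord scaler_sumr; congr (_ + _); apply: eq_bigr => i _.
  by rewrite (unsplitK (inl _)) scalerA.
by rewrite (unsplitK (inr _)).
Qed.

Lemma lin_span_ind A (P : E -> Prop) : P 0 ->
  (forall a x y, A x -> P y -> P (a *: x + y)) -> lin_span A `<=` P.
Proof.
move=> P0 PD _ [m [c [u [Au ->]]]]; elim: m c u Au => [|m IH] c u Au.
  by rewrite big_ord0.
by rewrite big_ord_recl; apply: PD => //; apply: IH.
Qed.

End LinearSpan.

Section Hilbert.
Variables (R : realType) (H : hilbertSpace R).
Implicit Types (x y z v w : H) (a e : R[i]) (A : set H).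

Lemma hdotC x y : hdot H x y = (hdot H y x)^*.
Proof. by rewrite (hermC (hdot H) x y) expr0 mul1r. Qed.

Lemma hdotDl x y z : hdot H (x + y) z = hdot H x z + hdot H y z.
Proof. exact: linearDl. Qed.

Lemma hdotZl a x z : hdot H (a *: x) z = a * hdot H x z.
Proof. exact: linearZl_LR. Qed.

Lemma hdotDr x y z : hdot H z (x + y) = hdot H z x + hdot H z y.
Proof. exact: linearDr. Qed.

Lemma hdotZr a x z : hdot H z (a *: x) = a^* * hdot H z x.
Proof. by rewrite linearZr_LR. Qed.

Lemma hdotBl x y z : hdot H (x - y) z = hdot H x z - hdot H y z.
Proof. exact: linearBl. Qed.

Lemma hdotBr x y z : hdot H z (x - y) = hdot H z x - hdot H z y.
Proof. exact: linearBr. Qed.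

Lemma hdot0l z : hdot H 0 z = 0.
Proof. exact: linear0l. Qed.

Lemma hdot0r z : hdot H z 0 = 0.
Proof. exact: linear0r. Qed.

Lemma cauchy_schwarz x y : `|hdot H x y| <= `|x| * `|y|.
Proof.
have [->|y0] := eqVneq y 0; first by rewrite hdot0r !normr0 mulr0.
have yy : 0 < hdot H y y by rewrite -hdot_norm exprn_gt0// normr_gt0.
pose a := hdot H x y / hdot H y y.
have aE : a^* = hdot H y x / hdot H y y.
  by rewrite /a fmorph_div /= [in RHS]hdotC [in X in _ = _ / X]hdotC.
have : 0 <= hdot H (x - a *: y) (x - a *: y) by rewrite -hdot_norm exprn_ge0.
rewrite hdotBl !hdotBr !hdotZl !hdotZr aE.
have -> : hdot H x x - hdot H y x / hdot H y y * hdot H x y -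
    (a * hdot H y x - a * (hdot H y x / hdot H y y * hdot H y y)) =
    hdot H x x - hdot H x y * hdot H y x / hdot H y y.
  rewrite divfK ?lt0r_neq0// subrr subr0 -mulrA [_^-1 * _]mulrC mulrA.
  by rewrite [hdot H y x * _]mulrC.
rewrite subr_ge0 ler_pdivrMr// -!hdot_norm [hdot H y x]hdotC -normCK.
by rewrite -exprMn ler_pXn2r ?nnegrE ?mulr_ge0.
Qed.

Lemma norm_hdot_inj x y : hdot H x x = hdot H y y -> `|x| = `|y|.
Proof.
rewrite -!hdot_norm => xy; apply/eqP.
by rewrite -(eqrXn2 (n := 2)) ?normr_ge0// xy.
Qed.

Lemma closureP A x : closure A x <-> forall e, 0 < e -> exists2 y, A y & `|x - y| < e.
Proof.
split=> [Ax e e0|Ax B /nbhs_normP[e /= e0 eB]].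
  have [y [Ay xy]] := Ax _ (nbhsx_ballx x _ e0).
  by exists y => //; move: xy; rewrite -ball_normE.
have [y Ay xy] := Ax e e0; exists y; split => //.
by apply: eB; rewrite /= .
Qed.

Lemma closure_lin_spanD A a x y : closure (lin_span A) x -> closure (lin_span A) y ->
  closure (lin_span A) (a *: x + y).
Proof.
move=> /closureP Ax /closureP Ay; apply/closureP => e e0.
have e2 : 0 < e / 2 by rewrite divr_gt0.
have a1 : 0 < `|a| + 1 by rewrite ltr_wpDl.
have [x' Ax' xx'] := Ax _ (divr_gt0 e2 a1); have [y' Ay' yy'] := Ay _ e2.
exists (a *: x' + y'); first exact: lin_spanD.
rewrite opprD addrACA -scalerBr [e]splitr.
rewrite (le_lt_trans (ler_normD _ _))// ler_ltD// normrZ.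
rewrite (le_trans (ler_wpM2l _ (ltW xx')))// mulrA ler_pdivrMr//.
by rewrite mulrC ler_wpM2l ?ltW// ltrDl.
Qed.

Lemma closed_subspace_cyclic A : closed_subspace (closure (lin_span A)).
Proof.
split; [exact: closed_closure| |by move=> a x y; exact: closure_lin_spanD].
by apply: subset_closure; exact: lin_span0.
Qed.

Lemma lin_span_sub W A : closed_subspace W -> A `<=` W -> closure (lin_span A) `<=` W.
Proof.
move=> [cW W0 WD] AW; rewrite [in X in _ `<=` X](closure_id W).1//.
apply: closure_subset; apply: lin_span_ind => // a x y /AW; exact: WD.
Qed.

Lemma ortho_dense A w : (forall x, A x -> hdot H x w = 0) ->
  closure (lin_span A) w -> w = 0.
Proof.
move=> Aw /closureP wA; apply/eqP; apply: contrapT => /negP w0.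
have [y yA wy] : exists2 y, lin_span A y & `|w - y| < `|w|.
  by apply: wA; rewrite normr_gt0.
have yw : hdot H y w = 0.
  move: y yA {wy}; apply: lin_span_ind => [|a x y /Aw xw yw]; first exact: hdot0l.
  by rewrite hdotDl hdotZl xw yw mulr0 addr0.
have : `|hdot H (w - y) w| < `|w| ^+ 2.
  rewrite (le_lt_trans (cauchy_schwarz _ _))// expr2 ltr_pM2r//.
  by rewrite normr_gt0.
by rewrite hdotBl yw subr0 -hdot_norm normrX normr_id ltxx.
Qed.

Definition isometric_op (U : H -> H) :=
  linear U /\ forall x y, hdot H (U x) (U y) = hdot H x y.

Lemma isometric_opB U x y : isometric_op U -> U (x - y) = U x - U y.
Proof. by case=> Ul _; rewrite addrC -scaleN1r Ul scaleN1r addrC. Qed.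

Lemma isometric_op_norm U x : isometric_op U -> `|U x| = `|x|.
Proof. by case=> _ Ui; exact: norm_hdot_inj. Qed.

Lemma isometric_op_eq U U' A : isometric_op U -> isometric_op U' ->
  closure (lin_span A) = setT -> (forall x, A x -> U x = U' x) -> U =1 U'.
Proof.
move=> iU iU' AT UU' x; apply/eqP; rewrite -subr_eq0 -normr_le0.
apply/ler_addgt0Pl => e e0; rewrite addr0.
have /closureP/(_ (e / 2))[|v vA xv] : closure (lin_span A) x by rewrite AT.
  by rewrite divr_gt0.
have Uv : U v = U' v.
  have [[Ul _] [Ul' _]] := (iU, iU').
  move: v vA {xv}; apply: lin_span_ind => [|a y z /UU' yU zU].
    by rewrite -(subrr 0) (isometric_opB _ _ iU) (isometric_opB _ _ iU') !subrr.
  by rewrite Ul Ul' yU zU.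
have -> : U x - U' x = U (x - v) - U' (x - v).
  by rewrite (isometric_opB _ _ iU) (isometric_opB _ _ iU') Uv opprB addrA subrK.
rewrite (le_trans (ler_normB _ _))// (isometric_op_norm _ iU).
rewrite (isometric_op_norm _ iU') [e]splitr.
by rewrite lerD// ltW.
Qed.

(** The graph of [U] is the closure of [G]. *)
Lemma isometric_relation_extension (G : H -> H -> Prop) :
  (forall a v v' w w', G v w -> G v' w' -> G (a *: v + v') (a *: w + w')) ->
  (forall v w, G v w -> `|w| = `|v|) ->
  (forall x e, 0 < e -> exists v w, G v w /\ `|x - v| < e) ->
  exists U, [/\ linear U, forall x, `|U x| = `|x| & forall v w, G v w -> U v = w].
Proof.
move=> GD Gn Gdense.
have G0 : G 0 0.
  have [v [w [Gvw _]]] := Gdense 0 1 ltr01.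
  by have := GD (-1) v v w w Gvw Gvw; rewrite !scaleN1r !addNr.
have GB v w v' w' : G v w -> G v' w' -> G (v - v') (w - w').
  by move=> Gv Gv'; have := GD (-1) _ _ _ _ Gv' Gv; rewrite !scaleN1r ![- _ + _]addrC.
pose Gc x y := forall e, 0 < e -> exists v w, [/\ G v w, `|x - v| < e & `|y - w| < e].
have GGc v w : G v w -> Gc v w.
  by move=> Gvw e e0; exists v, w; rewrite !subrr normr0.
have GcD a x x' y y' : Gc x y -> Gc x' y' -> Gc (a *: x + x') (a *: y + y').
  move=> Gx Gx' e e0.
  have e2 : 0 < e / 2 by rewrite divr_gt0.
  have a1 : 0 < `|a| + 1 by rewrite ltr_wpDl.
  have [v [w [Gv xv yw]]] := Gx _ (divr_gt0 e2 a1).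
  have [v' [w' [Gv' xv' yw']]] := Gx' _ e2.
  have bound (p q p' q' : H) : `|p - q| < e / 2 / (`|a| + 1) -> `|p' - q'| < e / 2 ->
      `|a *: p + p' - (a *: q + q')| < e.
    move=> pq pq'; rewrite opprD addrACA -scalerBr [e]splitr.
    rewrite (le_lt_trans (ler_normD _ _))// ler_ltD// normrZ.
    rewrite (le_trans (ler_wpM2l _ (ltW pq)))// mulrA ler_pdivrMr//.
    by rewrite mulrC ler_wpM2l ?ltW// ltrDl.
  exists (a *: v + v'), (a *: w + w'); split; [exact: GD|exact: bound|exact: bound].
have near_norm (p q : H) d : `|p - q| < d -> `|p| <= d + `|q|.
  by move=> pq; rewrite -lerBlDr (le_trans (lerB_dist _ _))// ltW.
have Gc_norm x y : Gc x y -> `|y| = `|x|.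
  move=> Gxy; apply/eqP; rewrite eq_le; apply/andP.
  split; apply/ler_addgt0Pl => e e0; have e2 : 0 < e / 2 by [rewrite divr_gt0];
    have [v [w [Gvw xv yw]]] := Gxy _ e2; rewrite [e]splitr -addrA.
    rewrite (le_trans (near_norm _ _ _ yw))// lerD2l (Gn _ _ Gvw).
    by apply: near_norm; rewrite distrC.
  rewrite (le_trans (near_norm _ _ _ xv))// lerD2l -(Gn _ _ Gvw).
  by apply: near_norm; rewrite distrC.
have Gc_total x : exists y, Gc x y.
  (* The partners under [G] of vectors close to [x] generate a Cauchy filter, as [G] preserves
     distances; its limit is the value at [x]. *)
  pose B e : set H := [set w | exists2 v, G v w & `|x - v| < e].
  pose F := filter_from [set e : R[i] | 0 < e] B.
  have FF : ProperFilter F.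
    apply: filter_from_proper; last first.
      by move=> e /= e0; have [v [w [Gvw xv]]] := Gdense x e e0; exists w, v.
    apply: filter_from_filter; first by exists 1; exact: ltr01.
    (* The order of [R[i]] is partial, but positive elements are real and hence comparable. *)
    move=> d e /= d0 e0; have /orP[de|ed] := real_leVge (gtr0_real d0) (gtr0_real e0).
      exists d => // w [v Gvw xv]; split; exists v => //; exact: lt_le_trans de.
    exists e => // w [v Gvw xv]; split; exists v => //; exact: lt_le_trans ed.
  have cF : cauchy F.
    apply: cauchy_exP => e e0; have e2 : 0 < e / 2 by rewrite divr_gt0.
    have [v [w [Gvw xv]]] := Gdense x _ e2; exists w; exists (e / 2) => //.
    move=> w' [v' Gvw' xv']; rewrite -ball_normE /= (Gn _ _ (GB _ _ _ _ Gvw Gvw')).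
    rewrite -[v](subrK x) -addrA [e]splitr (le_lt_trans (ler_normD _ _))//.
    by rewrite ltrD// distrC.
  have /cvg_ex[y Fy] : cvg F by exact: cauchy_cvg.
  exists y => e e0.
  have : F (B e) by exists e.
  have /fcvgrPdist_lt/(_ e e0) : F --> y by exact: Fy.
  move=> yF BF; have [w [[v Gvw xv] yw]] := filter_ex (filterI BF yF).
  by exists v, w.
have Gc_uniq x y y' : Gc x y -> Gc x y' -> y = y'.
  move=> Gxy Gxy'; apply/eqP; rewrite -subr_eq0 -normr_eq0.
  have := GcD (-1) _ _ _ _ Gxy' Gxy; rewrite !scaleN1r addNr addrC => /Gc_norm ->.
  by rewrite normr0.
have [U UG] := choice Gc_total; exists U; split.
- by move=> a x y; apply: Gc_uniq (UG _) _; exact: GcD.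
- by move=> x; exact: Gc_norm.
- by move=> v w /GGc; exact: Gc_uniq.
Qed.

(** Norms of sums determine the sum of the two mixed inner products; applying this to [y] and to
    ['i *: y] gives their sum and their difference. *)
Lemma isometric_op_polarization U :
  linear U -> (forall x, `|U x| = `|x|) -> isometric_op U.
Proof.
move=> Ul Un; split => // x y.
have UD u v : U (u + v) = U u + U v by rewrite -[u]scale1r Ul !scale1r.
have U0 : U 0 = 0 by have := Ul (-1) 0 0; rewrite scaler0 addr0 scaleN1r addNr.
have UZ a u : U (a *: u) = a *: U u.
  by rewrite -[a *: u]addr0 Ul U0 addr0.
have Uh u : hdot H (U u) (U u) = hdot H u u by rewrite -!hdot_norm Un.
have cross u v : hdot H (U u) (U v) + hdot H (U v) (U u) = hdot H u v + hdot H v u.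
  have := Uh (u + v); rewrite UD !hdotDl !hdotDr !Uh => /eqP.
  by rewrite -!addrA !(inj_eq (addrI _)) !addrA !(inj_eq (addIr _)) => /eqP.
have := cross x y; have := cross x ('i *: y).
rewrite UZ !hdotZl !hdotZr conjCi !mulNr addrC [in RHS]addrC -!mulrBr.
move=> /(mulfI (neq0Ci _)) E1 E2.
have : hdot H (U x) (U y) *+ 2 = hdot H x y *+ 2.
  move: E1 E2; set p := hdot _ _ _; set q := hdot _ _ _; set p' := hdot _ _ _.
  set q' := hdot _ _ _ => E1 E2.
  have -> : q *+ 2 = (q + p) - (p - q) by rewrite opprB addrACA subrr addr0.
  by rewrite E1 E2 opprB addrACA subrr addr0.
by move=> /eqP; rewrite -subr_eq0 -mulrnBl mulrn_eq0 subr_eq0 => /eqP.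
Qed.

End Hilbert.

(** * Spherical vectors from averages over a subgroup *)

Section Spherical.
Variables (R : realType) (n : nat) (T : regTree n) (H : hilbertSpace R).
Variable rho : hier T -> H -> H.
Hypothesis rho_rep : unitary_rep rho.
Implicit Types (g h : hier T) (x y w : H).

Lemma rep_isometric g : isometric_op (rho g).
Proof. by case: rho_rep => rl ri _ _ _; split; [exact: rl|exact: ri]. Qed.

Lemma repB g x y : rho g (x - y) = rho g x - rho g y.
Proof. exact: isometric_opB (rep_isometric g). Qed.

Lemma rep_norm g x : `|rho g x| = `|x|.
Proof. exact: isometric_op_norm (rep_isometric g). Qed.

Lemma rep1 x : rho 1%g x = x. Proof. by case: rho_rep. Qed.

Lemma repM g h x : rho (g * h)%g x = rho g (rho h x). Proof. by case: rho_rep. Qed.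

Lemma repP g a x y : rho g (a *: x + y) = a *: rho g x + rho g y.
Proof. by case: rho_rep => rl _ _ _ _; exact: rl. Qed.

Lemma rep_hdot g x y : hdot H (rho g x) (rho g y) = hdot H x y.
Proof. by case: rho_rep. Qed.

Lemma rep0 g : rho g 0 = 0.
Proof. by rewrite -[X in rho g X](subrr 0) repB subrr. Qed.

Lemma hdot_sumr m (u : 'I_m -> H) x : hdot H x (\sum_i u i) = \sum_i hdot H x (u i).
Proof.
elim: m u => [|m IH] u; first by rewrite !big_ord0 hdot0r.
by rewrite !big_ord_recl hdotDr IH.
Qed.

Lemma hdot_suml m (u : 'I_m -> H) x : hdot H (\sum_i u i) x = \sum_i hdot H (u i) x.
Proof.
elim: m u => [|m IH] u; first by rewrite !big_ord0 hdot0l.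
by rewrite !big_ord_recl hdotDl IH.
Qed.

Lemma norm_sum_orthogonal m (u : 'I_m -> H) (y : H) : (forall i, `|u i| = `|y|) ->
  (forall i j, i != j -> hdot H (u i) (u j) = 0) ->
  `|\sum_i u i| ^+ 2 = m%:R * `|y| ^+ 2.
Proof.
move=> un uo; rewrite hdot_norm hdot_suml.
rewrite (eq_bigr (fun=> `|y| ^+ 2)) => [|i _].
  by rewrite sumr_const card_ord mulr_natl.
rewrite hdot_sumr (bigD1 i)//= big1 ?addr0; first by rewrite -hdot_norm un.
by move=> j ji; rewrite uo// eq_sym.
Qed.

Lemma complex_archimedean (r : R[i]) : 0 <= r -> exists m, r < m.+1%:R.
Proof.
case: r => a b; rewrite lecE /= => /andP[/eqP b0 a0].
exists (Num.bound a); rewrite -(rmorph_nat (@real_complex R)) ltcE /= b0 eqxx /=.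
by rewrite (lt_le_trans (archi_boundP a0))// ler_nat leqnSn.
Qed.

Variables (K : set (hier T)) (E : H).
Hypotheses (E1 : `|E| = 1) (KE : fixed_by rho K E).

(** The hypothesis exhibits the projection onto the line of [E] as a limit of averages over [K].
    Closed invariant subspaces are therefore stable under it, and it is the identity on [K]-fixed
    vectors. *)
Lemma mean_to_spherical :
  (forall x e, 0 < e -> exists m (h : 'I_m.+1 -> hier T), (forall i, K (h i)) /\
     `|m.+1%:R^-1 *: \sum_i rho (h i) x - hdot H x E *: E| < e) ->
  spherical_on rho K (cyclic_span rho E) E.
Proof.
move=> mean.
have E0 : E != 0 by rewrite -normr_eq0 E1 oner_eq0.
have orbitE g : cyclic_span rho E (rho g E).
  by apply: subset_closure; apply: lin_span_gen; exists g.
have WE : cyclic_span rho E E by rewrite -[X in cyclic_span _ _ X]rep1; exact: orbitE.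
have limE (W : set H) x : closed_subspace W -> Defs.invariant rho W -> W x ->
    W (hdot H x E *: E).
  move=> [cW W0 WD] iW Wx; rewrite (closure_id W).1//; apply/closureP => e e0.
  have [m [h [Kh hx]]] := mean x e e0.
  exists (m.+1%:R^-1 *: \sum_i rho (h i) x); last by rewrite distrC.
  rewrite -[X in W X]addr0; apply: (WD) => //.
  apply: (big_ind W) => //; last by move=> i _; exact: iW.
  by move=> u v Wu Wv; rewrite -[u]scale1r; exact: WD.
split; last first.
  split => // w Ww wK; exists (hdot H w E).
  apply/eqP; rewrite -subr_eq0 -normr_le0; apply/ler_addgt0Pl => e e0; rewrite addr0.
  have [m [h [Kh]]] := mean w e e0; rewrite (eq_bigr (fun=> w)) => [|i _].
    rewrite sumr_const card_ord -[w *+ _]scaler_nat scalerA mulVf ?scale1r ?pnatr_eq0//.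
    exact: ltW.
  exact: wK.
split.
- exact: closed_subspace_cyclic.
- move=> g x /closureP xW; apply/closureP => e e0.
  have [y yE xy] := xW e e0; exists (rho g y); last by rewrite -repB rep_norm.
  move: y yE {xy}; apply: lin_span_ind => [|a _ y [h _ <-] IH].
    by rewrite rep0; exact: lin_span0.
  rewrite repP; apply: lin_spanD => //; apply: lin_span_gen.
  by exists (g * h)%g; rewrite ?repM.
- by exists E.
- move=> W' cW' iW' W'W; have [_ W'0 W'D] := cW'.
  have [W'E|nW'E] := pselect (W' E).
    right; apply/seteqP; split => //; apply: lin_span_sub => //.
    by move=> _ [g _ <-]; exact: iW'.
  left; apply/seteqP; split => [x W'x|_ ->//].
  have ort y : W' y -> hdot H y E = 0.
    move=> W'y; apply/eqP; apply: contrapT => /negP yE; apply: nW'E.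
    have := limE W' y cW' iW' W'y => W'c.
    by have := W'D (hdot H y E)^-1 _ _ W'c W'0; rewrite addr0 scalerA mulVf ?scale1r.
  (* By invariance and unitarity, [W'] is orthogonal to the whole orbit of [E], whose span is dense
     in the cyclic span. *)
  apply: (ortho_dense _ (W'W _ W'x)) => _ [g _ <-].
  rewrite hdotC -(rep_hdot (g^-1)%g) -repM mulVg rep1 ort ?conjC0//.
  exact: iW'.
Qed.

(** The mixing identity says that the components of the vectors [rho (h i) y] orthogonal to [E] are
    orthogonal to one another. A general [x] is approximated by such a [y], averaging being a
    contraction. *)
Lemma mixing_to_mean (A : set H) : closure (lin_span A) = setT ->
  (forall y m, lin_span A y -> exists h : 'I_m.+1 -> hier T, (forall i, K (h i)) /\
     forall i j, i != j ->
       hdot H (rho (h i) y) (rho (h j) y) = hdot H y E * hdot H E y) ->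
  forall x e, 0 < e -> exists m (h : 'I_m.+1 -> hier T), (forall i, K (h i)) /\
     `|m.+1%:R^-1 *: \sum_i rho (h i) x - hdot H x E *: E| < e.
Proof.
(* Three errors of at most [d] are added at the end; the fourth quarter of [e] is slack. *)
move=> AT mixing x e e0; pose d := e / 4; have d0 : 0 < d by rewrite divr_gt0.
have /closureP/(_ d d0)[y yA xy] : closure (lin_span A) x by rewrite AT.
pose c := hdot H y E; pose y0 := y - c *: E.
(* The [rho (h i) y0] are orthogonal, so their mean has squared norm
   [`|y0| ^+ 2 / m.+1]. *)
have [m hm] : exists m, `|y0| ^+ 2 / d ^+ 2 < m.+1%:R.
  by apply: complex_archimedean; rewrite divr_ge0 ?exprn_ge0// ltW.
have [h [Kh hmix]] := mixing y m yA; exists m, h; split => //.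
have hE i : rho (h i) E = E by exact: KE.
have yE i : hdot H (rho (h i) y) E = c by rewrite -[E in LHS](hE i) rep_hdot.
have Ey i : hdot H E (rho (h i) y) = c^* by rewrite hdotC yE.
have EE : hdot H E E = 1 by rewrite -hdot_norm E1 expr1n.
have hy0 i : rho (h i) y0 = rho (h i) y - c *: E.
  by rewrite repB -[c *: E]addr0 repP rep0 hE.
have sum0 : `|\sum_i rho (h i) y0| ^+ 2 = m.+1%:R * `|y0| ^+ 2.
  apply: norm_sum_orthogonal => [i|i j ij]; first exact: rep_norm.
  rewrite !hy0 hdotBl !hdotBr !hdotZl !hdotZr hmix// yE Ey EE [hdot H E y]hdotC.
  by rewrite -/c mulr1 [c^* * c]mulrC !subrr.
have m0 : 0 < m.+1%:R :> R[i] by rewrite ltr0n.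
have mV : `|m.+1%:R^-1| = m.+1%:R^-1 :> R[i] by rewrite ger0_norm// invr_ge0 ltW.
have avg0 : `|m.+1%:R^-1 *: \sum_i rho (h i) y0| < d.
  rewrite -(ltr_pXn2r (n := 2)) ?nnegrE// ?ltW// normrZ exprMn sum0 mV.
  rewrite expr2 mulrA mulfVK ?lt0r_neq0//.
  by rewrite ltr_pdivrMl// -ltr_pdivrMr ?exprn_gt0.
have avg1 : `|m.+1%:R^-1 *: \sum_i rho (h i) (x - y)| <= d.
  rewrite normrZ mV ler_pdivrMl//.
  rewrite (le_trans (ler_norm_sum _ _ _))//.
  rewrite (eq_bigr (fun=> `|x - y|)) => [|i _]; last exact: rep_norm.
  rewrite sumr_const card_ord -[leLHS]mulr_natl ler_pM2l// ltW//.
have avg2 : `|(c - hdot H x E) *: E| <= d.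
  rewrite normrZ E1 mulr1 -hdotBl (le_trans (cauchy_schwarz _ _))// E1 mulr1.
  by rewrite distrC ltW.
have -> : m.+1%:R^-1 *: \sum_i rho (h i) x - hdot H x E *: E =
  m.+1%:R^-1 *: (\sum_i rho (h i) (x - y)) + m.+1%:R^-1 *: (\sum_i rho (h i) y0)
  + (c - hdot H x E) *: E.
  rewrite -scalerDr -big_split /=.
  have -> : \sum_i (rho (h i) (x - y) + rho (h i) y0) = \sum_i (rho (h i) x - c *: E).
    by apply: eq_bigr => i _; rewrite repB hy0 addrA subrK.
  rewrite sumrB sumr_const card_ord scalerBr -[c *: E *+ _]scaler_nat.
  rewrite (scalerA m.+1%:R^-1 m.+1%:R).
  by rewrite mulVf ?lt0r_neq0// scale1r scalerBl addrA subrK.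
rewrite (le_lt_trans (ler_normD _ _))//.
rewrite (le_lt_trans (lerD (ler_normD _ _) (lexx _)))//.
have -> : e = d + d + d + d.
  by rewrite -[LHS](@divfK _ 4) ?pnatr_eq0// -/d mulr_natr !mulrSr mulr0n add0r.
rewrite ltr_wpDr ?(ltW d0)// ltr_leD//.
by rewrite ler_ltD.
Qed.

End Spherical.

(** * The partition into orbits and their complement *)

Section Partition.
Variables (n : nat) (T : regTree n) (iota N : nat) (O : 'I_N -> set (set (boundary T))).
Hypotheses (n_gt1 : (1 < n)%N) (O_orbit : forall p, is_aut_orbit iota (O p))
  (O_inj : injective O).
Implicit Types (A : set (boundary T)) (g : hier T) (h : aut T).

Let n_gt0 : (0 < n)%N. Proof. exact: ltnW. Qed.

Local Notation Pi := (orbit_part iota O).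
Local Notation index := (part_index Pi).

Lemma orbit_clop p A : O p A -> clop_class iota A.
Proof. by have [B DB ->] := O_orbit p => -[h _ <-]; exact: hier_clop_class. Qed.

(** Any member generates its orbit, so two orbits with a common member are equal; with [O_inj] this
    makes the parts disjoint. *)
Lemma orbit_base p A : O p A -> O p = [set hier_of_aut h @` A | h in setT].
Proof.
have [B DB ->] := O_orbit p => -[k _ <-]; apply/seteqP; split => _ [h _ <-].
  exists (aut_comp h (aut_inv k)) => //.
  by rewrite -hier_imageM -!hier_of_autM -hier_of_autV -mulgA mulVg mulg1.
by exists (aut_comp h k) => //; rewrite -hier_imageM hier_of_autM.
Qed.

Lemma orbit_aut p h A : O p A -> O p (hier_of_aut h @` A).
Proof. by move=> /orbit_base ->; exists h. Qed.

Lemma orbit_disjoint p q A : O p A -> O q A -> p = q.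
Proof. by move=> /orbit_base Op /orbit_base Oq; apply: O_inj; rewrite Op Oq. Qed.

Lemma orbit_part_lift q : Pi (lift ord_max q) = O q.
Proof. by rewrite /orbit_part liftK. Qed.

Lemma orbit_part_max : Pi ord_max = clop_class iota `\` \bigcup_q O q.
Proof. by rewrite /orbit_part unlift_none. Qed.

Lemma part_clop p A : Pi p A -> clop_class iota A.
Proof.
case: (unliftP ord_max p) => [q|] ->; first by rewrite orbit_part_lift; exact: orbit_clop.
by rewrite orbit_part_max => -[].
Qed.

Lemma part_disjoint p q A : Pi p A -> Pi q A -> p = q.
Proof.
case: (unliftP ord_max p) => [p'|] ->; case: (unliftP ord_max q) => [q'|] ->;
  rewrite ?orbit_part_lift ?orbit_part_max //.
- by move=> Op Oq; rewrite (orbit_disjoint Op Oq).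
- by move=> Op [_ nO]; case: nO; exists p'.
- by move=> [_ nO] Oq; case: nO; exists q'.
Qed.

Lemma part_indexE p A : Pi p A -> index A = p.
Proof.
move=> pA; have : [set q | Pi q A] (index A) by apply: xgetPex; exists p.
by move=> /part_disjoint; apply.
Qed.

Lemma part_indexP A : clop_class iota A -> Pi (index A) A.
Proof.
move=> DA; suff [p pA] : exists p, Pi p A by rewrite (part_indexE pA).
have [[q _ Oq]|nO] := pselect ((\bigcup_q O q) A).
  by exists (lift ord_max q); rewrite orbit_part_lift.
by exists ord_max; rewrite orbit_part_max.
Qed.

Lemma part_aut p h A : Pi p A -> Pi p (hier_of_aut h @` A).
Proof.
case: (unliftP ord_max p) => [q|] ->; first by rewrite orbit_part_lift; exact: orbit_aut.
rewrite orbit_part_max => -[DA nO]; split; first exact: hier_clop_class.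
move=> [q _ /(orbit_aut (aut_inv h))]; rewrite -hier_of_autV hier_imageK => Oq.
by apply: nO; exists q.
Qed.

Lemma part_index_aut h A : clop_class iota A -> index (hier_of_aut h @` A) = index A.
Proof. by move=> DA; apply: part_indexE; apply: part_aut; exact: part_indexP. Qed.

Lemma orbit_leave_finite g q : finite_set [set A | O q A /\ ~ O q (g @` A)].
Proof.
have [B DB OE] := O_orbit q; have [t tadj BE] := clop_class_union DB.
apply: sub_finite_set (aut_orbit_moved_finite n_gt1 g tadj) => A [].
rewrite OE BE => -[h _ <-] nOg; exists h => // k Ek; apply: nOg.
by rewrite Ek; exists (aut_comp k h); rewrite // -hier_of_autM hier_imageM.
Qed.

(** Of two different parts at least one is an orbit. If it is the source, its members leave it under
    [g]; if it is the target, the images [g A] leave it under [g^-1]. *)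
Lemma moved_finite g p q : p != q -> finite_set (moved Pi p q g).
Proof.
case: (unliftP ord_max p) => [p'|] pE pq.
  apply: sub_finite_set (orbit_leave_finite g p') => A [].
  rewrite pE orbit_part_lift => Op Oq; split => // Op'.
  move/eqP: pq; apply; rewrite pE; apply: (@part_disjoint _ _ (g @` A)) => //.
  by rewrite orbit_part_lift.
case: (unliftP ord_max q) => [q'|] qE; last by rewrite pE qE eqxx in pq.
have := finite_image (fun A => (g^-1)%g @` A) (orbit_leave_finite (g^-1)%g q').
apply: sub_finite_set => A []; rewrite pE qE orbit_part_lift orbit_part_max.
move=> [DA nO] Oq; exists (g @` A); last exact: hier_imageK.
by split => //; rewrite hier_imageK => OA; apply: nO; exists q'.
Qed.

Lemma index_moved_finite g :
  finite_set [set A | clop_class iota A /\ index (g @` A) <> index A].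
Proof.
have : finite_set (\bigcup_(pq in [set pq : 'I_N.+1 * 'I_N.+1 | pq.1 != pq.2])
    moved Pi pq.1 pq.2 g).
  by apply: bigcup_finite; [exact: finite_finset|move=> pq; exact: moved_finite].
apply: sub_finite_set => A [DA Ag]; exists (index A, index (g @` A)).
  by rewrite /= eq_sym; apply/eqP.
by split; apply: part_indexP => //; exact: hier_clop_class.
Qed.

(** The factors are grouped by the parts containing [A] and [g A]. Off the finite set [M] each
    factor is a diagonal entry, equal to 1; for the same reason the diagonal exponents, possibly
    infinite, do not affect the value. *)
Lemma prod_pow_count (R : realType) (S : 'M[R]_N.+1) (S1 : forall p, S p p = 1) g :
  \big[*%R/1]_(A \in clop_class iota) (S (index A) (index (g @` A)))%:C%C =
  (\prod_p \prod_q pow_count (S p q) (theta Pi p q g))%:C%C.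
Proof.
set M := [set A | clop_class iota A /\ index (g @` A) <> index A].
have finM : finite_set M by exact: index_moved_finite.
rewrite -(@fsbig_widen _ _ _ _ M); last 2 first.
- by move=> A [].
- move=> A [DA nM] /=; rewrite (_ : index (g @` A) = index A) ?S1//.
  by apply: contrapT => iA; apply: nM.
rewrite fsbig_finite//= -rmorph_prod; congr (_%:C%C).
rewrite (partition_big index xpredT)//=; apply: eq_bigr => p _.
rewrite (partition_big (fun A => index (g @` A)) xpredT)//=; apply: eq_bigr => q _.
rewrite (eq_bigr (fun=> S p q)) => [|A /andP[/eqP -> /eqP ->]//].
rewrite big_const_seq iter_mulr_1.
have [<-|pq] := eqVneq p q.
  rewrite S1 expr1n /pow_count /theta /set_count.
  by case: ifP => _; rewrite ?expr1n ?eqxx.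
rewrite /theta /set_count asboolT; last exact: moved_finite.
rewrite /pow_count -size_filter; congr (_ ^+ _); apply: perm_size.
apply: uniq_perm; rewrite ?filter_uniq ?fset_uniq// => A.
rewrite mem_filter.
rewrite -[A \in enum_fset (fset_set M)]/(A \in fset_set M).
rewrite -[RHS]/(A \in fset_set (moved Pi p q g)).
rewrite !in_fset_set//; last exact: moved_finite.
apply/idP/idP => [/andP[/andP[/eqP pA /eqP qA]] /set_mem[DA _]|/set_mem[pA qA]].
  apply/mem_set; split; first by rewrite -pA; exact: part_indexP.
  by rewrite -qA; apply: part_indexP; exact: hier_clop_class.
rewrite (part_indexE pA) (part_indexE qA) !eqxx /=; apply/mem_set; split.
  exact: part_clop pA.
by rewrite (part_indexE pA) (part_indexE qA); apply/eqP; rewrite eq_sym.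
Qed.

End Partition.

(** * The tensor product representation *)

Section TensorRepresentation.
Variables (R : realType) (n : nat) (T : regTree n) (iota : nat).
Hypothesis n_gt1 : (1 < n)%N.
Variables (W : lmodType R[i]) (ip : {dot W for Num.conj}).
Variable xi : set (boundary T) -> W.
Local Notation D := (@clop_class n T iota).
Hypotheses (ip_xi : forall A, ip (xi A) (xi A) = 1)
  (xi_aut : forall h A, D A -> xi (hier_of_aut h @` A) = xi A)
  (xi_moved : forall g : hier T, finite_set [set A | D A /\ xi (g @` A) <> xi A]).
Variables (H : hilbertSpace R) (tau : (set (boundary T) -> W) -> H).
Hypothesis tau_tensor : is_tensor_product D (fun=> ip) xi tau.
Implicit Types (x y : set (boundary T) -> W) (g : hier T) (h : aut T).
Implicit Types (A : set (boundary T)) (v w : H).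

Let n_gt0 : (0 < n)%N. Proof. exact: ltnW. Qed.

Local Notation almost := (almost_xi D xi).
Local Notation decomposable := [set tau x | x in almost].

Lemma almost_xi_refl : almost xi.
Proof. by apply: sub_finite_set (finite_set0 _) => A [_]. Qed.

Lemma tau_hdot x y : almost x -> almost y ->
  hdot H (tau x) (tau y) = \big[*%R/1]_(A \in D) ip (x A) (y A).
Proof. by case: tau_tensor => + _; apply. Qed.

Lemma tau_dense : closure (lin_span decomposable) = setT.
Proof. by case: tau_tensor. Qed.

Lemma hier_preimageE g A : g @^-1` A = (g^-1)%g @` A.
Proof. by rewrite hier_imageE invgK. Qed.

Lemma permuteE g x A : permute_factors g x A = x ((g^-1)%g @` A).
Proof. by rewrite /permute_factors hier_preimageE. Qed.

Lemma permute_image g x A : permute_factors g x (g @` A) = x A.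
Proof. by rewrite permuteE hier_imageK. Qed.

Lemma permute1 x : permute_factors 1%g x = x.
Proof. by apply/funext => A; rewrite permuteE invg1 hier_image1. Qed.

Lemma hier_imageVK g A : g @` ((g^-1)%g @` A) = A.
Proof. by rewrite -hier_imageM mulgV hier_image1. Qed.

(** At index [g A] the permuted family holds [x A]. This differs from [xi (g A)] only if [x A]
    differs from [xi A] or [g] changes [xi] at [A], and both happen finitely often. *)
Lemma permute_almost g x : almost x -> almost (permute_factors g x).
Proof.
move=> ax.
have : finite_set ([set A | D A /\ x A <> xi A] `|`
    [set A | D A /\ xi (g @` A) <> xi A]) by rewrite finite_setU.
move=> /(finite_image (fun A => g @` A)); apply: sub_finite_set => A [DA].
rewrite permuteE => xA; exists ((g^-1)%g @` A); last exact: hier_imageVK.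
have DgA : D ((g^-1)%g @` A) by exact: hier_clop_class.
have [xiA|xiA] := pselect (xi ((g^-1)%g @` A) = xi A).
  by left; split; rewrite // xiA.
by right; split; rewrite // hier_imageVK => /esym.
Qed.

Lemma hier_bij_clop g : set_bij D D (fun A => g @` A).
Proof.
split.
- by move=> A DA; exact: hier_clop_class.
- by move=> A B _ _ /(can_inj (hier_imageK g)).
- move=> A DA; exists ((g^-1)%g @` A); first exact: hier_clop_class.
  exact: hier_imageVK.
Qed.

Lemma permute_hdot g x y : almost x -> almost y ->
  hdot H (tau (permute_factors g x)) (tau (permute_factors g y)) =
  hdot H (tau x) (tau y).
Proof.
move=> ax ay; rewrite !tau_hdot//; try exact: permute_almost.
rewrite (reindex_fsbig (fun A => g @` A) D); last exact: hier_bij_clop.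
by apply: eq_fsbigr => A _; rewrite !permute_image.
Qed.

(** The squared norm of [tau x - tau y] expands into four products over [D], which see only the
    components there and cancel. *)
Lemma tau_eq x y : almost x -> almost y -> (forall A, D A -> x A = y A) ->
  tau x = tau y.
Proof.
move=> ax ay xy; apply/eqP; rewrite -subr_eq0 -normr_eq0 -[_ == 0]orbb -mulf_eq0 -expr2.
rewrite hdot_norm hdotBl !hdotBr !tau_hdot//.
have E (f f' k k' : set (boundary T) -> W) : (forall A, D A -> f A = f' A) ->
    (forall A, D A -> k A = k' A) ->
    \big[*%R/1]_(A \in D) ip (f A) (k A) = \big[*%R/1]_(A \in D) ip (f' A) (k' A).
  by move=> ff' kk'; apply: eq_fsbigr => A /set_mem DA; rewrite ff'// kk'.
have yx A : D A -> y A = x A by move=> /xy.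
have xx A : D A -> x A = x A by [].
by rewrite (E y x x x yx xx) (E y x y x yx yx) (E x x y x xx yx) !subrr.
Qed.

(** The graph is spanned by pairs of decomposable vectors. Inner products of first and of second
    components agree on it, so it is isometric and in particular single-valued, whatever linear
    relations hold among decomposable vectors. *)
Lemma isometry_of_hier g : exists U, isometric_op U /\
  forall x, almost x -> U (tau x) = tau (permute_factors g x).
Proof.
pose Q : set (H * H)%type :=
  [set p | exists2 x, almost x & p = (tau x, tau (permute_factors g x))].
pose G v w := lin_span Q (v, w).
have Ghdot p q : lin_span Q p -> lin_span Q q ->
    hdot H p.2 q.2 = hdot H p.1 q.1.
  move=> Qp Qq; move: p Qp; apply: lin_span_ind => [|a _ p [x ax ->] IHp] /=.
    by rewrite !hdot0l.
  rewrite !hdotDl !hdotZl IHp; congr (_ * _ + _).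
  move: q Qq {IHp}; apply: lin_span_ind => [|b _ q [y ay ->] IHq] /=.
    by rewrite !hdot0r.
  by rewrite !hdotDr !hdotZr IHq permute_hdot.
have [|||U [Ul Un UG]] := @isometric_relation_extension R H G.
- by move=> a v v' w w'; exact: lin_spanD.
- by move=> v w Gvw; apply: norm_hdot_inj; exact: (Ghdot (v, w) (v, w)).
- move=> v e e0.
  have /closureP/(_ e e0)[u uD vu] : closure (lin_span decomposable) v.
    by rewrite tau_dense.
  exists u; suff [w Gw] : exists w, G u w by exists w.
  move: u uD {vu}; apply: lin_span_ind => [|a _ u [x ax <-] [w Gw]].
    by exists 0; exact: lin_span0.
  exists (a *: tau (permute_factors g x) + w).
  have Qx : Q (tau x, tau (permute_factors g x)) by exists x.
  exact: (lin_spanD a (lin_span_gen Qx) Gw).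
exists U; split; first exact: isometric_op_polarization.
by move=> x ax; apply: UG; apply: lin_span_gen; exists x.
Qed.

Definition tensor_rep g : H -> H := projT1 (cid (isometry_of_hier g)).

Lemma tensor_rep_isometric g : isometric_op (tensor_rep g).
Proof. by rewrite /tensor_rep; case: cid => U []. Qed.

Lemma tensor_rep_tau g x : almost x ->
  tensor_rep g (tau x) = tau (permute_factors g x).
Proof. by rewrite /tensor_rep; case: cid => U /= [_ +]; apply. Qed.

Lemma isometric_op_comp (U U' : H -> H) :
  isometric_op U -> isometric_op U' -> isometric_op (U \o U').
Proof.
move=> [Ul Ui] [Ul' Ui']; split; last by move=> v w; rewrite /= Ui Ui'.
by move=> a v w; rewrite /= Ul' Ul.
Qed.

Lemma tensor_repM g g' v : tensor_rep (g * g')%g v = tensor_rep g (tensor_rep g' v).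
Proof.
have ic := isometric_op_comp (tensor_rep_isometric g) (tensor_rep_isometric g').
apply: (isometric_op_eq (tensor_rep_isometric _) ic tau_dense) => _ [x ax <-] /=.
by rewrite !tensor_rep_tau//; exact: permute_almost.
Qed.

Lemma tensor_rep1 v : tensor_rep 1%g v = v.
Proof.
have i1 : @isometric_op R H id by split.
apply: (isometric_op_eq (tensor_rep_isometric _) i1 tau_dense) => _ [x ax <-] /=.
by rewrite tensor_rep_tau// permute1.
Qed.

Lemma clop_stabilizer A : D A ->
  exists F : seq T, forall h, {in F, forall u, h u = u} -> hier_of_aut h @` A = A.
Proof.
move=> /clop_class_union[s sadj ->]; exists (edge_vertices s) => h hF.
rewrite aut_image_union; congr ball_union; rewrite -[RHS]map_id.
apply/eq_in_map => -[a b] es; rewrite /aut_edge /=.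
by rewrite !hF// (edge_vertices1 es, edge_vertices2 es).
Qed.

Lemma clop_stabilizer_seq (L : seq (set (boundary T))) :
  (forall A, A \in L -> D A) -> exists F : seq T, forall h,
    {in F, forall u, h u = u} -> forall A, A \in L -> hier_of_aut h @` A = A.
Proof.
elim: L => [|A L IH] DL; first by exists [::].
have [|F FP] := IH; first by move=> B BL; apply: DL; rewrite inE BL orbT.
have [F' F'P] := clop_stabilizer (DL A (mem_head _ _)).
exists (F' ++ F) => h hF B; rewrite inE => /orP[/eqP ->|BL].
  by apply: F'P => u uF; apply: hF; rewrite mem_cat uF.
by apply: FP BL => u uF; apply: hF; rewrite mem_cat uF orbT.
Qed.

Definition supported (L : seq (set (boundary T))) x :=
  forall A, D A -> A \notin L -> x A = xi A.

Lemma almost_supported x : almost x ->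
  exists2 L, (forall A, A \in L -> D A) & supported L x.
Proof.
move=> /finite_seqP[L LE]; exists L => [A AL|A DA AL].
  by have : [set` L] A by []; rewrite -LE => -[].
apply: contrapT => xA; have : [set` L] A by rewrite -LE.
by move=> /= AL'; rewrite AL' in AL.
Qed.

(** Fixing enough vertices fixes each of the finitely many sets where [x] may differ from [xi]; the
    remaining indices are permuted, and there [x] is the [Aut]-invariant [xi]. *)
Lemma tensor_rep_stabilizer v : lin_span decomposable v ->
  exists F : seq T, forall h, {in F, forall u, h u = u} ->
    tensor_rep (hier_of_aut h) v = v.
Proof.
move: v; apply: lin_span_ind => [|a _ v [x ax <-] [F FP]].
  exists [::] => h _; have ih := tensor_rep_isometric (hier_of_aut h).
  by rewrite -[X in tensor_rep _ X](subrr 0) (isometric_opB _ _ ih) subrr.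
have [L DL xL] := almost_supported ax; have [F' F'P] := clop_stabilizer_seq DL.
exists (F' ++ F) => h hF.
have [Ul _] := tensor_rep_isometric (hier_of_aut h); rewrite Ul; congr (_ *: _ + _).
  rewrite tensor_rep_tau//; apply: tau_eq => //; first exact: permute_almost.
  have {}F'P : forall A, A \in L -> hier_of_aut h @` A = A.
    by apply: F'P => u uF; apply: hF; rewrite mem_cat uF.
  move=> A DA; rewrite permuteE; set B := _ @` A.
  have BA : hier_of_aut h @` B = A by exact: hier_imageVK.
  have DB : D B by exact: hier_clop_class.
  have [BL|BL] := boolP (B \in L); first by rewrite -BA F'P.
  have [AL|AL] := boolP (A \in L); last by rewrite !xL// -BA xi_aut.
  by rewrite /B -[in LHS](F'P A AL) hier_imageK.
by apply: FP => u uF; apply: hF; rewrite mem_cat uF orbT.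
Qed.

Lemma tensor_rep_continuous v : continuous (fun g => tensor_rep g v).
Proof.
move=> g; apply/(@cvgrPdist_lt _ _ _ (nbhs g) (nbhs_filter g)) => e e0.
have e2 : 0 < e / 2 by rewrite divr_gt0.
have /closureP/(_ _ e2)[u uD vu] : closure (lin_span decomposable) v.
  by rewrite tau_dense.
have [F FP] := tensor_rep_stabilizer uD.
(* A left coset of the pointwise stabilizer of [F], open by the choice of the topology. *)
pose U := [set g' | exists2 h : aut T, {in F, forall u, h u = u} &
  g' = (g * hier_of_aut h)%g].
have oU : open U.
  move=> _ [h hF ->]; exists F => h' h'F; exists (aut_comp h h').
    by move=> z zF; rewrite /= h'F// hF.
  by rewrite -hier_of_autM mulgA.
have Ug : U g.
  by exists (aut_id T) => //; rewrite -[hier_of_aut _]/(1%g : hier T) mulg1.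
apply: filterS (open_nbhs_nbhs (conj oU Ug)) => _ [h hF ->].
have ig := tensor_rep_isometric g; have ih := tensor_rep_isometric (hier_of_aut h).
rewrite tensor_repM -(isometric_opB _ _ ig) (isometric_op_norm _ ig).
rewrite -[v in v - _](subrK u) -addrA -[X in _ + (X - _)](FP h hF).
rewrite -(isometric_opB _ _ ih) [e]splitr (le_lt_trans (ler_normD _ _))//.
by rewrite (isometric_op_norm _ ih) ltrD// distrC.
Qed.

Lemma tensor_rep_unitary : unitary_rep tensor_rep.
Proof.
split.
- by move=> g; case: (tensor_rep_isometric g).
- by move=> g; case: (tensor_rep_isometric g).
- exact: tensor_rep1.
- exact: tensor_repM.
- exact: tensor_rep_continuous.
Qed.

Lemma norm_tau_xi : `|tau xi| = 1.
Proof.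
apply/eqP; rewrite -(eqrXn2 (n := 2)) ?normr_ge0// expr1n hdot_norm tau_hdot//;
  try exact: almost_xi_refl.
by rewrite fsbig1.
Qed.

Lemma tau_xi_fixed : fixed_by tensor_rep (range (@hier_of_aut n T)) (tau xi).
Proof.
move=> _ [h _ <-]; rewrite tensor_rep_tau; last exact: almost_xi_refl.
apply: tau_eq; [exact: permute_almost almost_xi_refl|exact: almost_xi_refl|].
by move=> A DA; rewrite permuteE hier_of_autV xi_aut.
Qed.

(** At each index one of the families holds the unit vector [xi A], so [ip (x A) (y A)] is
    [ip (x A) (xi A)] times [ip (xi A) (y A)]. *)
Lemma tau_hdot_disjoint x y : almost x -> almost y ->
  (forall A, D A -> x A = xi A \/ y A = xi A) ->
  hdot H (tau x) (tau y) = hdot H (tau x) (tau xi) * hdot H (tau xi) (tau y).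
Proof.
move=> ax ay xy; have axi := almost_xi_refl; rewrite !tau_hdot//.
pose X := [set A | D A /\ x A <> xi A] `|` [set A | D A /\ y A <> xi A].
have finX : finite_set X by rewrite finite_setU.
have XD : X `<=` D by move=> A [[]|[]].
have outX A : (D `\` X) A -> x A = xi A /\ y A = xi A.
  by move=> [DA nX]; split; apply: contrapT => ?; apply: nX; [left|right].
rewrite -!(@fsbig_widen _ _ _ _ X D) -?fsbig_split//=.
- apply: eq_fsbigr => A /set_mem /XD /xy[->|->]; by rewrite ip_xi ?mul1r ?mulr1.
- by move=> A /outX[xA yA]; rewrite /= ?xA ?yA ip_xi.
- by move=> A /outX[xA yA]; rewrite /= ?xA ?yA ip_xi.
- by move=> A /outX[xA yA]; rewrite /= ?xA ?yA ip_xi.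
Qed.

Lemma permute_supported h L x : supported L x ->
  supported [seq hier_of_aut h @` A | A <- L] (permute_factors (hier_of_aut h) x).
Proof.
move=> xL A DA AL; rewrite permuteE.
have DB := hier_clop_class n_gt0 ((hier_of_aut h)^-1)%g DA.
rewrite xL//; first by rewrite hier_of_autV xi_aut.
by apply: contraNN AL => BL; apply/mapP; exists (((hier_of_aut h)^-1)%g @` A) => //;
  rewrite hier_imageVK.
Qed.

(** A finite combination involves finitely many indices; a common list [L] for all its terms can be
    moved off itself by an automorphism. *)
Lemma lin_span_supported v : lin_span decomposable v ->
  exists2 L, (forall A, A \in L -> D A) &
    lin_span [set tau x | x in [set x | almost x /\ supported L x]] v.
Proof.
have mono (L L' : seq (set (boundary T))) : {subset L <= L'} ->
  lin_span [set tau x | x in [set x | almost x /\ supported L x]] `<=`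
  lin_span [set tau x | x in [set x | almost x /\ supported L' x]].
  move=> LL'; apply: lin_span_ind => [|a _ u [x [ax xL] <-] IH].
    exact: lin_span0.
  apply: lin_spanD => //; apply: lin_span_gen; exists x => //; split => // A DA AL'.
  by apply: xL => //; apply: contraNN AL'; exact: LL'.
move: v; apply: lin_span_ind => [|a _ v [x ax <-] [L DL vL]].
  by exists [::] => //; exact: lin_span0.
have [L' DL' xL'] := almost_supported ax; exists (L' ++ L).
  by move=> A; rewrite mem_cat => /orP[/DL'|/DL].
apply: lin_spanD; last by apply: (mono L) vL => A AL; rewrite mem_cat AL orbT.
apply: lin_span_gen; exists x => //; split => // A DA.
by rewrite mem_cat negb_or => /andP[AL' _]; exact: xL'.
Qed.

(** Each new automorphism is taken to avoid the finite list of all translates chosen before it. *)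
Lemma disjoint_translates (L : seq (set (boundary T))) m : (forall A, A \in L -> D A) ->
  exists h : nat -> aut T, forall i j, (i < j < m)%N ->
    forall A, A \in L -> hier_of_aut (h j) @` A \notin
      [seq hier_of_aut (h i) @` B | B <- L].
Proof.
move=> DL; elim: m => [|m [h hm]]; first by exists (fun=> aut_id T) => i j;
  rewrite ltn0 andbF.
have [|k kP] := @clop_class_move n T n_gt1 iota L
  (flatten [seq [seq hier_of_aut (h i) @` B | B <- L] | i <- seq.iota 0 m]) DL.
  by move=> A /flatten_mapP[i _ /mapP[B BL ->]]; apply: hier_clop_class => //; exact: DL.
exists (fun i => if i == m then k else h i) => i j /andP[ij]; rewrite ltnS leq_eqVlt.
move=> /orP[/eqP jm|jm] A AL.
  rewrite jm in ij *; rewrite eqxx (ltn_eqF ij).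
  apply: contraNN (kP A AL) => AB; apply/flatten_mapP; exists i => //.
  by rewrite mem_iota.
by rewrite (ltn_eqF jm) (ltn_eqF (ltn_trans ij jm)); apply: hm => //; rewrite ij.
Qed.

(** Both sides extend to sesquilinear expressions in two vectors, so it suffices to treat
    decomposable vectors supported in [L], whose translates have disjoint supports. *)
Lemma tensor_rep_mixing v m : lin_span decomposable v ->
  exists h : 'I_m.+1 -> hier T, (forall i, range (@hier_of_aut n T) (h i)) /\
    forall i j, i != j -> hdot H (tensor_rep (h i) v) (tensor_rep (h j) v) =
      hdot H v (tau xi) * hdot H (tau xi) v.
Proof.
move=> /lin_span_supported[L DL vL].
have [k kP] := disjoint_translates m.+1 DL.
exists (fun i => hier_of_aut (k i)); split; first by move=> i; exists (k i).
have mixing (i j : nat) :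
    (forall A, A \in L -> hier_of_aut (k j) @` A \notin
      [seq hier_of_aut (k i) @` B | B <- L]) ->
    hdot H (tensor_rep (hier_of_aut (k i)) v) (tensor_rep (hier_of_aut (k j)) v) =
      hdot H v (tau xi) * hdot H (tau xi) v.
  move=> ij; have [Uil Uii] := tensor_rep_isometric (hier_of_aut (k i)).
  have [Ujl Uji] := tensor_rep_isometric (hier_of_aut (k j)).
  have Ui0 : tensor_rep (hier_of_aut (k i)) 0 = 0.
    by have := Uil (-1) 0 0; rewrite scaler0 addr0 scaleN1r addNr.
  have Uj0 : tensor_rep (hier_of_aut (k j)) 0 = 0.
    by have := Ujl (-1) 0 0; rewrite scaler0 addr0 scaleN1r addNr.
  suff : forall v w,
      lin_span [set tau x | x in [set x | almost x /\ supported L x]] v ->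
      lin_span [set tau x | x in [set x | almost x /\ supported L x]] w ->
      hdot H (tensor_rep (hier_of_aut (k i)) v) (tensor_rep (hier_of_aut (k j)) w) =
      hdot H v (tau xi) * hdot H (tau xi) w by apply.
  move=> v' w vL' wL; move: v' vL'; apply: lin_span_ind => [|a _ u [x [ax xL] <-] IH].
    by rewrite Ui0 !hdot0l mul0r.
  rewrite Uil !hdotDl !hdotZl {}IH mulrDl -mulrA; congr (_ * _ + _).
  move: w wL; apply: lin_span_ind => [|b _ w [y [ay yL] <-] IH].
    by rewrite Uj0 !hdot0r mulr0.
  rewrite Ujl !hdotDr !hdotZr {}IH mulrDr mulrCA; congr (_ * _ + _).
  (* The operators preserve inner products and fix [tau xi]; inserting them on the right gives the
     form of [tau_hdot_disjoint]. *)
  rewrite -[hdot H (tau x) _]Uii -[hdot H _ (tau y)]Uji.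
  rewrite [tensor_rep (hier_of_aut (k i)) (tau xi)]tau_xi_fixed; last by exists (k i).
  rewrite [tensor_rep (hier_of_aut (k j)) (tau xi)]tau_xi_fixed; last by exists (k j).
  rewrite !tensor_rep_tau//; apply: tau_hdot_disjoint; try exact: permute_almost.
  move=> A DA; have xLk := permute_supported (h := k i) xL.
  have yLk := permute_supported (h := k j) yL.
  have [AL|AL] := boolP (A \in [seq hier_of_aut (k i) @` B | B <- L]); last first.
    by left; apply: xLk.
  right; apply: yLk => //; apply: contraTN AL => /mapP[B BL ->]; exact: ij.
move=> i j; rewrite neq_ltn => /orP[ij|ji].
  by apply: mixing => A AL; apply: kP => //; rewrite ij ltn_ord.
(* [kP] compares translates for increasing indices only; the other order follows by conjugation. *)
rewrite hdotC mixing; last by move=> A AL; apply: kP => //; rewrite ji ltn_ord.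
by rewrite rmorphM /= -!hdotC mulrC.
Qed.

Lemma tensor_rep_spherical : spherical_on tensor_rep (range (@hier_of_aut n T))
  (cyclic_span tensor_rep (tau xi)) (tau xi).
Proof.
apply: (mean_to_spherical tensor_rep_unitary norm_tau_xi tau_xi_fixed).
apply: (mixing_to_mean tensor_rep_unitary norm_tau_xi tau_xi_fixed tau_dense).
move=> v m; exact: tensor_rep_mixing.
Qed.

Lemma tensor_spherical_function g : spherical_function tensor_rep (tau xi) g =
  \big[*%R/1]_(A \in D) ip (xi A) (xi (g @` A)).
Proof.
have axi := almost_xi_refl.
rewrite /spherical_function tensor_rep_tau// tau_hdot//; last exact: permute_almost.
rewrite (reindex_fsbig (fun A => g @` A) D); last exact: hier_bij_clop.
by apply: eq_fsbigr => A _; rewrite permute_image.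
Qed.

End TensorRepresentation.

Lemma cdot_complexify (R : realType) (V : lmodType R) (dot : {dot V for idfun})
    (u v : V) :
  cdot dot (complexify u) (complexify v) = (dot u v)%:C%C.
Proof. by rewrite /cdot /= linear0l linear0l linear0r addr0 subr0. Qed.

Theorem mainTheorem4 (R : realType) (n : nat) (hn : (2 <= n)%N) (T : regTree n)
    (iota : nat) (hiota : (iota < n.-1)%N)
    (N : nat) (O : 'I_N -> set (set (boundary T)))
    (hO : forall p, is_aut_orbit iota (O p)) (hOinj : injective O) :
  let Pi := orbit_part iota O in
  (forall g p q, p != q -> finite_set (moved Pi p q g)) /\
  (forall (S : 'M[R]_N.+1)
      (hSsym : S^T = S)
      (hSpsd : forall x : 'rV[R]_N.+1, 0 <= (x *m S *m x^T) 0 0)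
      (hSdiag : forall p, S p p = 1)
      (V : vectType R) (dotV : {dot V for idfun}) (e : 'I_N.+1 -> V)
      (hspan : <<[seq e p | p : 'I_N.+1]>>%VS = fullv)
      (hgram : forall p q, dotV (e p) (e q) = S p q),
    let xi := fun A => complexify (e (part_index Pi A)) in
    forall (H : hilbertSpace R)
      (tau : (set (boundary T) -> complexification V) -> H)
      (htau : is_tensor_product (clop_class iota) (fun=> cdot dotV) xi tau),
    exists rho : hier T -> H -> H,
      [/\ unitary_rep rho,
          forall g x, almost_xi (clop_class iota) xi x ->
            almost_xi (clop_class iota) xi (permute_factors g x) /\
            rho g (tau x) = tau (permute_factors g x),
          spherical_on rho (range (@hier_of_aut n T))
            (cyclic_span rho (tau xi)) (tau xi),
          `|tau xi| = 1
        & forall g, spherical_function rho (tau xi) g =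
            (\prod_p \prod_q pow_count (S p q) (theta Pi p q g))%:C%C]).
Proof.
move=> Pi; split; first by move=> g p q; exact: moved_finite.
move=> S _ _ hSdiag V dotV e _ hgram xi H tau htau.
have ip_xi A : cdot dotV (xi A) (xi A) = 1.
  by rewrite cdot_complexify hgram hSdiag.
have xi_aut (h : aut T) A : clop_class iota A -> xi (hier_of_aut h @` A) = xi A.
  by move=> DA; rewrite /xi part_index_aut.
have xi_moved (g : hier T) :
    finite_set [set A | clop_class iota A /\ xi (g @` A) <> xi A].
  apply: sub_finite_set (index_moved_finite hn hO hOinj g) => A [DA xiA].
  by split => // iA; apply: xiA; rewrite /xi -/Pi iA.
exists (tensor_rep hn xi_moved htau); split.
- exact: tensor_rep_unitary.
- move=> g x ax; split; first exact: permute_almost.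
  exact: tensor_rep_tau.
- exact: tensor_rep_spherical.
- exact: norm_tau_xi htau.
- move=> g; rewrite tensor_spherical_function -(prod_pow_count hn hO hOinj hSdiag).
  by apply: eq_fsbigr => A _; rewrite -hgram; exact: cdot_complexify.
Qed.
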